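(* Let $\mathcal L:\mathcal M_{2^n}\to\mathcal M_{2^n}$ be a Lindbladian with fixed point a full-rank state $\sigma>0$ that satisfies a modified logarithmic Sobolev inequality (MLSI) with constant $\alpha>0$. Let $s\mapsto H_s$ be a continuous family of Hamiltonians on $n$ qubits, let $\mathcal S_s(\rho)=-i[\rho,H_s]+\mathcal L(\rho)$ be the corresponding time-dependent Lindbladian, and let $\mathcal T_t$ be the evolution it generates from time $0$ to $t$. Then for all $n$-qubit states $\rho$ and all $t>0$, $$D(\mathcal T_t(\rho)\|\sigma)\le e^{-\alpha t}D(\rho\|\sigma)+\int_0^t e^{-\alpha(t-\tau)}\left\|\sigma^{-\frac12}[H_\tau,\sigma]\sigma^{-\frac12}\right\|d\tau .$$
   Context: $\mathcal M_{2^n}$ is the space of $2^n\times2^n$ complex matrices; $\|\cdot\|$ is the operator norm; $[X,Y]=XY-YX$; $\log$ is natural; $D(\rho\|\sigma)=\mathrm{tr}(\rho(\log\rho-\log\sigma))$ is the quantum relative entropy. A Lindbladian is a generator of a semigroup $(e^{t\mathcal L})_{t\ge0}$ of quantum channels; $\sigma$ is a fixed point if $e^{t\mathcal L}(\sigma)=\sigma$ for all $t\ge0$. $\mathcal L$ satisfies an MLSI with constant $\alpha$ if $D(e^{t\mathcal L}(\rho)\|\sigma)\le e^{-\alpha t}D(\rho\|\sigma)$ for all $n$-qubit states $\rho$ and all $t\ge0$. The evolution is $\mathcal T_t(\rho)=\rho(t)$, where $\rho(\cdot)$ solves $\frac{d}{dt}\rho(t)=\mathcal S_t(\rho(t))$,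 $\rho(0)=\rho$; equivalently $\mathcal T_t=\lim_{N\to\infty}e^{\frac tN\mathcal S_{t_N}}\circ\cdots\circ e^{\frac tN\mathcal S_{t_1}}$ with $t_l=tl/N$. *)

(* Defs.v *)
From mathcomp Require Import all_boot all_order all_algebra.
From mathcomp Require Import complex.
From mathcomp Require Import all_classical all_reals all_analysis.

Set Implicit Arguments.
Unset Strict Implicit.
Unset Printing Implicit Defensive.

Import Order.TTheory GRing.Theory Num.Theory.
Import numFieldNormedType.Exports.
Local Open Scope classical_set_scope.
Local Open Scope ring_scope.
Local Open Scope sesquilinear_scope.
Local Open Scope complex_scope.

Definition commutator (R : realType) (N : nat) (X Y : 'M[R[i]]_N) : 'M[R[i]]_N :=
  X *m Y - Y *m X.

(* [0 <= z] in [R[i]] means that z is real and nonnegative, so that a positive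
   semidefinite matrix is in particular Hermitian. *)
Definition psdmx (R : realType) (N : nat) (A : 'M[R[i]]_N) : Prop :=
  forall v : 'cV[R[i]]_N, 0 <= (v ^t* *m A *m v) 0 0.

Definition state (R : realType) (N : nat) (rho : 'M[R[i]]_N) : Prop :=
  psdmx rho /\ \tr rho = 1.

(* Functional calculus f(A) of a Hermitian matrix A: [spectral_diag A] is the
   row of its eigenvalues (which are real) and [spectralmx A] is a unitary
   matrix diagonalizing it. *)
Definition funmx (R : realType) (N : nat) (f : R -> R) (A : 'M[R[i]]_N) :
    'M[R[i]]_N :=
  invmx (spectralmx A)
    *m diag_mx (map_mx (fun z => (f (complex.Re z))%:C) (spectral_diag A))
    *m spectralmx A.

Definition logmx (R : realType) (N : nat) (A : 'M[R[i]]_N) : 'M[R[i]]_N :=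
  funmx (@ln R) A.

Definition invsqrtmx (R : realType) (N : nat) (A : 'M[R[i]]_N) : 'M[R[i]]_N :=
  funmx (fun x => (Num.sqrt x)^-1) A.

(* Meant for a full-rank sigma, in which case it is finite. Since [ln 0 = 0],
   the convention 0 log 0 = 0 holds on the kernel of rho. The trace is real for
   Hermitian arguments. *)
Definition relative_entropy (R : realType) (N : nat) (rho sigma : 'M[R[i]]_N) :
    R :=
  complex.Re (\tr (rho *m (logmx rho - logmx sigma))).

Definition l2norm (R : realType) (N : nat) (v : 'cV[R[i]]_N) : R :=
  Num.sqrt (\sum_(k < N) Normc.normc (v k 0) ^+ 2).

Definition opnorm (R : realType) (N : nat) (A : 'M[R[i]]_N) : R :=
  sup [set l2norm (A *m v) | v in [set v : 'cV[R[i]]_N | l2norm v <= 1]].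

(* e^{tL}(X) = sum_k t^k/k! L^k(X), the series being summed on the real and
   imaginary parts of each entry. *)
Definition expop (R : realType) (N : nat) (L : 'M[R[i]]_N -> 'M[R[i]]_N)
    (t : R) (X : 'M[R[i]]_N) : 'M[R[i]]_N :=
  let u k := (t ^+ k / k`!%:R)%:C *: iter k L X in
  \matrix_(i, j)
    (limn (series (fun k => complex.Re (u k i j)))
     +i* limn (series (fun k => complex.Im (u k i j)))).

(* The matrices of size \sum_(i < k) N, cut into k * k blocks of size N, are
   M_k (x) M_N, and the map below is id_k (x) Phi. *)
Definition completely_positive (R : realType) (N : nat)
    (Phi : 'M[R[i]]_N -> 'M[R[i]]_N) : Prop :=
  forall (k : nat) (X : 'M[R[i]]_(\sum_(a < k) N)),
    psdmx X -> psdmx (\mxblock_(a < k, b < k) Phi (submxblock X a b)).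

Definition quantum_channel (R : realType) (N : nat)
    (Phi : 'M[R[i]]_N -> 'M[R[i]]_N) : Prop :=
  [/\ linear Phi, completely_positive Phi & forall X, \tr (Phi X) = \tr X].

Definition lindbladian (R : realType) (N : nat)
    (L : {linear 'M[R[i]]_N -> 'M[R[i]]_N}) : Prop :=
  forall t : R, 0 <= t -> quantum_channel (expop L t).

Definition fixed_point (R : realType) (N : nat)
    (L : 'M[R[i]]_N -> 'M[R[i]]_N) (sigma : 'M[R[i]]_N) : Prop :=
  forall t : R, 0 <= t -> expop L t sigma = sigma.

Definition mlsi (R : realType) (N : nat) (L : 'M[R[i]]_N -> 'M[R[i]]_N)
    (sigma : 'M[R[i]]_N) (alpha : R) : Prop :=
  forall (rho : 'M[R[i]]_N) (t : R), state rho -> 0 <= t ->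
    relative_entropy (expop L t rho) sigma
      <= expR (- alpha * t) * relative_entropy rho sigma.

Definition mx_continuous_on (R : realType) (N : nat) (D : set R)
    (F : R -> 'M[R[i]]_N) : Prop :=
  forall i j, {within D, continuous (fun s => complex.Re (F s i j))} /\
              {within D, continuous (fun s => complex.Im (F s i j))}.

Definition mx_is_derive (R : realType) (N : nat) (F : R -> 'M[R[i]]_N)
    (t : R) (A : 'M[R[i]]_N) : Prop :=
  forall i j,
    is_derive t 1 (fun s => complex.Re (F s i j)) (complex.Re (A i j)) /\
    is_derive t 1 (fun s => complex.Im (F s i j)) (complex.Im (A i j)).

Definition driven_lindbladian (R : realType) (N : nat)
    (L : 'M[R[i]]_N -> 'M[R[i]]_N) (H : R -> 'M[R[i]]_N)
    (s : R) (rho : 'M[R[i]]_N) : 'M[R[i]]_N :=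
  - 'i%C *: commutator rho (H s) + L rho.

(* [T t X] is the value at time t >= 0 of the solution of the initial value
   problem d/dt Y = S_t(Y), Y(0) = X; the values at t < 0 are irrelevant, whence
   continuity up to 0 and the equation for t > 0. *)
Definition is_evolution (R : realType) (N : nat)
    (S T : R -> 'M[R[i]]_N -> 'M[R[i]]_N) : Prop :=
  forall X : 'M[R[i]]_N,
    [/\ T 0 X = X,
        mx_continuous_on `[0, +oo[ (fun t => T t X)
      & forall t, 0 < t -> mx_is_derive (fun s => T s X) t (S t (T t X))].

(* Main.v *)
(* The state is propagated by a product formula, each step being a unitary
   conjugation for the Hamiltonian part followed by e^{hL}. The conjugation
   preserves tr(rho log rho), so to first order it changes the relative entropy by
   h Re(i tr(rho [H, log sigma])), and the MLSI contracts the result. The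
   commutator term is at most ||sigma^{-1/2} [H, sigma] sigma^{-1/2}||: since
     [H, log sigma] = int_0^oo (sigma + x)^{-1} [H, sigma] (sigma + x)^{-1} dx,
   it is the image of sigma^{-1/2} [H, sigma] sigma^{-1/2} under a unital
   completely positive map; here the integral is replaced by the monotonicity in
   x of a primitive. Summing the steps gives a Riemann sum of the integral in the
   bound. The product formula converges to the evolution, and the bound survives
   the limit because the relative entropy is lower semicontinuous, by Klein's
   inequality; no differentiability of the entropy at singular states is needed. *)
Require Import Defs.
From mathcomp Require Import all_boot all_order all_algebra.
From mathcomp Require Import complex.
From mathcomp Require Import all_classical all_reals all_analysis.
From mathcomp Require Import ring lra.

Set Implicit Arguments.
Unset Strict Implicit.
Unset Printing Implicit Defensive.

Import Order.TTheory GRing.Theory Num.Theory.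
Import numFieldNormedType.Exports.
Local Open Scope classical_set_scope.
Local Open Scope ring_scope.
Local Open Scope sesquilinear_scope.
Local Open Scope complex_scope.

(** The entropy has no Lipschitz modulus at singular states, so a norm error made in one step cannot
    be turned into an entropy error there. Hence the discrete trajectory consists of exact states
    and carries two separate estimates: its distance to the evolution, by a discrete Gronwall
    argument, and its own entropy bound. The two meet only at time t, where lower semicontinuity
    acts in the required direction. Within a step, the error must therefore fall on tr(rho log
    sigma), which is linear in rho. This is why the Hamiltonian part has to be exactly unitary and
    not merely unitary to first order; a Cayley transform provides this with one matrix inversion.
    All constants are uniform over the steps because states form a bounded set. *)

(** * Real part, imaginary part and modulus of complex numbers *)

Section ComplexNumbers.
Variable R : realType.
Implicit Types z w : R[i].

Lemma RecD z w : complex.Re (z + w) = complex.Re z + complex.Re w.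
Proof. by case: z w => [a b] [c d]. Qed.

Lemma ImcD z w : complex.Im (z + w) = complex.Im z + complex.Im w.
Proof. by case: z w => [a b] [c d]. Qed.

Lemma RecN z : complex.Re (- z) = - complex.Re z.
Proof. by case: z. Qed.

Lemma ImcN z : complex.Im (- z) = - complex.Im z.
Proof. by case: z. Qed.

Lemma RecB z w : complex.Re (z - w) = complex.Re z - complex.Re w.
Proof. by rewrite RecD RecN. Qed.

Lemma ImcB z w : complex.Im (z - w) = complex.Im z - complex.Im w.
Proof. by rewrite ImcD ImcN. Qed.

Lemma Rec_sum I (r : seq I) (P : pred I) (F : I -> R[i]) :
  complex.Re (\sum_(i <- r | P i) F i) = \sum_(i <- r | P i) complex.Re (F i).
Proof. exact: (big_morph (@complex.Re R) RecD). Qed.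

Lemma RecZ (a : R) z : complex.Re (a%:C * z) = a * complex.Re z.
Proof. by case: z => x y /=; rewrite mul0r subr0. Qed.

Lemma ImcZ (a : R) z : complex.Im (a%:C * z) = a * complex.Im z.
Proof. by case: z => x y /=; rewrite mul0r addr0. Qed.

Lemma normc_ge0 z : 0 <= Normc.normc z.
Proof. by case: z => a b; exact: sqrtr_ge0. Qed.

Lemma sqr_normc_def z :
  Normc.normc z ^+ 2 = complex.Re z ^+ 2 + complex.Im z ^+ 2.
Proof. by case: z => a b /=; rewrite sqr_sqrtr // addr_ge0 ?sqr_ge0. Qed.

Lemma mul_conjC_normc z : z^* * z = (Normc.normc z ^+ 2)%:C.
Proof.
rewrite sqr_normc_def; case: z => a b; apply/eqP.
by rewrite eq_complex /=; apply/andP; split; apply/eqP; ring.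
Qed.

Lemma normc_le_ReIm z :
  Normc.normc z <= `|complex.Re z| + `|complex.Im z|.
Proof.
rewrite -(@ler_pXn2r _ 2) ?nnegrE ?addr_ge0 ?normc_ge0 //.
rewrite sqr_normc_def sqrrD !real_normK ?num_real // lerD2r lerDl.
by rewrite mulrn_wge0 // mulr_ge0.
Qed.

Lemma Rec_le_normc z : `|complex.Re z| <= Normc.normc z.
Proof.
rewrite -(@ler_pXn2r _ 2) ?nnegrE ?normc_ge0 //.
by rewrite sqr_normc_def -normrX ger0_norm ?sqr_ge0 // lerDl sqr_ge0.
Qed.

Lemma Imc_le_normc z : `|complex.Im z| <= Normc.normc z.
Proof.
rewrite -(@ler_pXn2r _ 2) ?nnegrE ?normc_ge0 //.
by rewrite sqr_normc_def -normrX ger0_norm ?sqr_ge0 // lerDr sqr_ge0.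
Qed.

Lemma normc_real (x : R) : Normc.normc x%:C = `|x|.
Proof. by rewrite /= expr0n addr0 sqrtr_sqr. Qed.

Lemma normc_i : Normc.normc ('i : R[i]) = 1.
Proof. by rewrite /= expr0n expr1n add0r sqrtr1. Qed.

Lemma normc_conj z : Normc.normc z^* = Normc.normc z.
Proof. by case: z => a b /=; rewrite sqrrN. Qed.

Lemma normc_sum I (r : seq I) (P : pred I) (F : I -> R[i]) :
  Normc.normc (\sum_(i <- r | P i) F i)
    <= \sum_(i <- r | P i) Normc.normc (F i).
Proof.
elim/big_ind2: _ => //; first by rewrite Normc.normc0.
move=> x y z w xy zw; apply: le_trans (lerD xy zw).
exact: (@le_normcD _ y w).
Qed.

End ComplexNumbers.

(** * Positive semidefinite matrices and functional calculus *)

Section PositiveSemidefinite.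
Variables (R : realType) (N : nat).
Local Notation M := 'M[R[i]]_N.
Implicit Types (A B X U P S : M) (f g : R -> R).

Lemma trmxCM m n p (A : 'M[R[i]]_(m, n)) (B : 'M[R[i]]_(n, p)) :
  (A *m B)^t* = B^t* *m A^t*.
Proof. by rewrite trmx_mul map_mxM. Qed.

Lemma trmxCD m n (A B : 'M[R[i]]_(m, n)) : (A + B)^t* = A^t* + B^t*.
Proof. by rewrite linearD map_mxD. Qed.

Lemma trmxCB m n (A B : 'M[R[i]]_(m, n)) : (A - B)^t* = A^t* - B^t*.
Proof. by rewrite linearB map_mxB. Qed.

Lemma trmxCZ m n (a : R[i]) (A : 'M[R[i]]_(m, n)) :
  (a *: A)^t* = (conjc a) *: A^t*.
Proof. by rewrite linearZ map_mxZ. Qed.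

Lemma trmxC1 : (1%:M : M)^t* = 1%:M.
Proof. by rewrite trmx1 map_mx1. Qed.

Lemma psd_conj A P : psdmx A -> psdmx (P^t* *m A *m P).
Proof.
move=> pA v; have := pA (P *m v).
by rewrite trmxCM !mulmxA.
Qed.

Lemma quad_delta A i j :
  ((delta_mx i 0 : 'cV[R[i]]_N)^t* *m A *m (delta_mx j 0 : 'cV[R[i]]_N)) 0 0
  = A i j.
Proof. by rewrite -mulmxA -colE trmx_delta map_delta_mx -rowE !mxE. Qed.

Lemma psd_diag A i : psdmx A -> 0 <= A i i.
Proof. by move=> /(_ (delta_mx i 0)); rewrite quad_delta. Qed.

Lemma psd_pair A i j (c : R[i]) : psdmx A ->
  0 <= A i i + c * A i j + (c^* * A j i + c^* * (c * A j j)).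
Proof.
move=> /(_ (delta_mx i 0 + c *: delta_mx j 0)).
have mxD (X Y : 'M[R[i]]_1) : (X + Y) 0 0 = X 0 0 + Y 0 0 by rewrite mxE.
have mxZ (a : R[i]) (X : 'M[R[i]]_1) : (a *: X) 0 0 = a * X 0 0 by rewrite mxE.
rewrite trmxCD trmxCZ !(mulmxDl, mulmxDr) -!(scalemxAl, scalemxAr) !(mxD, mxZ).
by rewrite !quad_delta addrACA.
Qed.

(** Polarization: the form is real at e_i, e_j, e_i + e_j and e_i + i e_j, which forces A_ij and
    A_ji to be conjugate. *)
Lemma psd_herm A : psdmx A -> A^t* = A.
Proof.
move=> pA; apply/matrixP => i j; rewrite !mxE.
have:= psd_pair i j 1 pA; have:= psd_pair i j 'i pA.
have:= psd_diag i pA; have:= psd_diag j pA.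
rewrite !lecE; case: (A i i) => a a'; case: (A j j) => b b'.
case: (A i j) => c c'; case: (A j i) => d d' /=.
move=> /andP[/eqP ? _] /andP[/eqP ? _] /andP[/eqP ? _] /andP[/eqP ? _].
by apply/eqP; rewrite eq_complex /=; apply/andP; split; apply/eqP; lra.
Qed.

Definition eigval A (k : 'I_N) : R := complex.Re (spectral_diag A 0 k).

Lemma spectral_unitr A : spectralmx A *m (spectralmx A)^t* = 1%:M.
Proof. exact/unitarymxP/spectral_unitarymx. Qed.

Lemma spectral_unitl A : (spectralmx A)^t* *m spectralmx A = 1%:M.
Proof. exact: mulmx1C (spectral_unitr A). Qed.

Lemma funmxE f A : funmx f A = (spectralmx A)^t*
  *m diag_mx (\row_k (f (eigval A k))%:C) *m spectralmx A.
Proof.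
rewrite /funmx (invmx_unitary (spectral_unitarymx A)).
have -> : map_mx (fun z => (f (complex.Re z))%:C) (spectral_diag A)
    = \row_k (f (eigval A k))%:C by apply/rowP => k; rewrite !mxE.
by [].
Qed.

Lemma herm_hermsymmx A : A^t* = A -> A \is hermsymmx.
Proof. by move=> hA; apply/is_hermitianmxP; rewrite expr0 scale1r hA. Qed.

Lemma hermsymmx_herm A : A \is hermsymmx -> A^t* = A.
Proof. by move/is_hermitianmxP; rewrite expr0 scale1r => <-. Qed.

Lemma funmx_id A : A^t* = A -> funmx id A = A.
Proof.
move=> /herm_hermsymmx hA.
rewrite [RHS](orthomx_spectralP (hermitian_normalmx hA)) /funmx.
have -> : map_mx (fun z => (id (complex.Re z))%:C) (spectral_diag A)
    = spectral_diag A.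
  apply/rowP => k; rewrite mxE; apply: RRe_real.
  exact: (mxOverP (hermitian_spectral_diag_real hA)).
by [].
Qed.

Lemma funmx_eq f g A :
  (forall k, f (eigval A k) = g (eigval A k)) -> funmx f A = funmx g A.
Proof.
move=> fg; rewrite !funmxE.
have -> : \row_k (f (eigval A k))%:C = \row_k (g (eigval A k))%:C.
  by apply/rowP => k; rewrite !mxE fg.
by [].
Qed.

Lemma funmxM f g A : funmx f A *m funmx g A = funmx (fun x => f x * g x) A.
Proof.
rewrite !funmxE; set P := spectralmx A.
have -> : \row_k (f (eigval A k) * g (eigval A k))%:C = \row_k
    ((\row_l (f (eigval A l))%:C) 0 k * (\row_l (g (eigval A l))%:C) 0 k).
  by apply/rowP => k; rewrite !mxE rmorphM.
by rewrite -mulmx_diag !mulmxA -(mulmxA _ P) spectral_unitr mulmx1.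
Qed.

Lemma funmx1 A : funmx (fun=> 1) A = 1%:M.
Proof.
rewrite funmxE (_ : diag_mx _ = 1%:M) ?mulmx1 ?spectral_unitl //.
by rewrite -diag_const_mx; congr diag_mx; apply/rowP => k; rewrite !mxE.
Qed.

Lemma funmx_adj f A : (funmx f A)^t* = funmx f A.
Proof.
rewrite !funmxE !trmxCM trmxCK -mulmxA.
rewrite tr_diag_mx map_diag_mx.
have -> : map_mx Num.conj (\row_k (f (eigval A k))%:C) = \row_k (f (eigval A k))%:C.
  by apply/rowP => k; rewrite !mxE; exact: conjc_real.
by [].
Qed.

Lemma tr_funmx X f A : \tr (X *m funmx f A) = \sum_k (f (eigval A k))%:C
  * (spectralmx A *m X *m (spectralmx A)^t*) k k.
Proof.
rewrite funmxE mulmxA mxtrace_mulC !mulmxA; apply: eq_bigr => k _.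
by rewrite mul_mx_diag !mxE mulrC.
Qed.

Lemma Re_tr_funmx X f A : complex.Re (\tr (X *m funmx f A)) =
  \sum_k f (eigval A k)
    * complex.Re ((spectralmx A *m X *m (spectralmx A)^t*) k k).
Proof. by rewrite tr_funmx Rec_sum; apply: eq_bigr => k _; rewrite RecZ. Qed.

Lemma Re_tr_funmxl f A : complex.Re (\tr (funmx f A)) = \sum_k f (eigval A k).
Proof.
rewrite -[funmx f A]mul1mx Re_tr_funmx mulmx1 spectral_unitr.
by apply: eq_bigr => k _; rewrite mxE eqxx mulr1.
Qed.

Lemma spectral_diagonalize A : A^t* = A ->
  spectralmx A *m A *m (spectralmx A)^t*
    = diag_mx (\row_k (eigval A k)%:C).
Proof.
move=> hA; rewrite -{2}(funmx_id hA) funmxE !mulmxA spectral_unitr mul1mx.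
by rewrite -mulmxA spectral_unitr mulmx1.
Qed.

Lemma eigval_ge0 A k : psdmx A -> 0 <= eigval A k.
Proof.
move=> pA; have /(psd_diag k) := psd_conj ((spectralmx A)^t*) pA.
rewrite trmxCK spectral_diagonalize ?psd_herm //.
by rewrite !mxE eqxx mulr1n ler0c.
Qed.

Lemma trace_eigval A : A^t* = A -> complex.Re (\tr A) = \sum_k eigval A k.
Proof. by move=> hA; rewrite -{1}(funmx_id hA) Re_tr_funmxl. Qed.

Lemma psd_factor A : psdmx A -> exists S : M, A = S *m S^t*.
Proof.
move=> pA; exists (funmx Num.sqrt A); rewrite funmx_adj funmxM.
rewrite -{1}(funmx_id (psd_herm pA)); apply: funmx_eq => k.
by rewrite -expr2 sqr_sqrtr // eigval_ge0.
Qed.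

(** Conjugation by a unitary keeps A invertible, and an invertible diagonal matrix has no zero
    diagonal entry. *)
Lemma eigval_gt0 A k : psdmx A -> \rank A = N -> 0 < eigval A k.
Proof.
move=> pA rA; rewrite lt_def eigval_ge0 // andbT; apply/eqP => ek.
have uA : A \in unitmx by rewrite -row_full_unit /row_full rA.
have : spectralmx A *m A *m (spectralmx A)^t* \in unitmx.
  rewrite !unitmx_mul uA spectral_unit /=.
  by apply: unitarymx_unit; rewrite trmxC_unitary spectral_unitarymx.
rewrite spectral_diagonalize ?psd_herm // => /mulVmx/matrixP/(_ k k)/eqP.
rewrite mul_mx_diag !mxE ek mulr0 eqxx eq_sym.
by rewrite oner_eq0.
Qed.

End PositiveSemidefinite.

(** * Klein's inequality *)

Section Entropy.
Variables (R : realType) (N : nat).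
Local Notation M := 'M[R[i]]_N.
Implicit Types (A B X U P S : M).

(** Scalar form of Klein's inequality: ln (b / r) <= b / r - 1, multiplied by r. At r = 0 it reads -
    b <= 0, as the product 0 * ln 0 vanishes. *)
Lemma xlnx_tangent (r b : R) : 0 <= r -> 0 < b -> r - b <= r * ln r - r * ln b.
Proof.
rewrite le_eqVlt => /predU1P[<-|r0] b0.
  by rewrite !mul0r subrr sub0r oppr_le0 ltW.
have := @le_ln1Dx R (b / r - 1); rewrite [1 + _]addrC subrK ln_div //.
have br0 : 0 < b / r by exact: divr_gt0.
rewrite ltrBrDr addNr => /(_ br0).
rewrite -(ler_pM2l r0) mulrBr mulrBr mulr1 mulrCA divff ?gt_eqF // mulr1.
lra.
Qed.

Lemma unitarymx_entries_row A i : A *m A^t* = 1%:M ->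
  \sum_j Normc.normc (A i j) ^+ 2 = 1.
Proof.
move=> /matrixP/(_ i i); rewrite !mxE eqxx => /(congr1 (@complex.Re R)).
rewrite Rec_sum /= => <-; apply: eq_bigr => j _.
by rewrite !mxE mulrC mul_conjC_normc.
Qed.

Lemma unitarymx_entries_col A j : A *m A^t* = 1%:M ->
  \sum_i Normc.normc (A i j) ^+ 2 = 1.
Proof.
move=> /mulmx1C/matrixP/(_ j j); rewrite !mxE eqxx => /(congr1 (@complex.Re R)).
rewrite Rec_sum /= => <-; apply: eq_bigr => i _.
by rewrite !mxE mul_conjC_normc.
Qed.

Definition negentropy A : R := complex.Re (\tr (A *m logmx A)).

Lemma negentropyE A : A^t* = A ->
  negentropy A = \sum_k eigval A k * ln (eigval A k).
Proof.
by move=> hA; rewrite /negentropy /logmx -{1}(funmx_id hA) funmxM Re_tr_funmxl.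
Qed.

Lemma conj_change_basis X U P (Q D : M) : P *m X *m P^t* = D -> P^t* *m P = 1%:M ->
  Q *m (U *m X *m U^t*) *m Q^t* = Q *m U *m P^t* *m D *m (P *m U^t* *m Q^t*).
Proof.
move=> <- uP; rewrite !mulmxA -(mulmxA _ (P^t*) P) uP mulmx1.
by rewrite -(mulmxA _ (P^t*) P) uP mulmx1.
Qed.

Lemma conj_diag_mx_entry P (r : 'I_N -> R) j :
  complex.Re ((P *m diag_mx (\row_k (r k)%:C) *m P^t*) j j)
    = \sum_i Normc.normc (P j i) ^+ 2 * r i.
Proof.
rewrite mul_mx_diag mxE Rec_sum; apply: eq_bigr => i _; rewrite !mxE.
by rewrite mulrAC [P j i * _]mulrC mul_conjC_normc -rmorphM.
Qed.

(* The weights [w j i] below are the squared moduli of the overlaps of the two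
   eigenbases; they are doubly stochastic, which reduces the claim to the
   tangent inequality for [x ln x]. The shift [d] allows a singular [A]. *)
Lemma klein_inequality X A U (d : R) :
  psdmx X -> psdmx A -> U *m U^t* = 1%:M -> 0 < d ->
  complex.Re (\tr (X *m (U^t* *m funmx (fun x => ln (x + d)) A *m U)))
    + complex.Re (\tr X) - complex.Re (\tr A) - N%:R * d <= negentropy X.
Proof.
move=> pX pA uU d0; have hX := psd_herm pX; have hA := psd_herm pA.
rewrite negentropyE // (trace_eigval hX) (trace_eigval hA).
have -> F : \tr (X *m (U^t* *m F *m U)) = \tr (U *m X *m U^t* *m F).
  by rewrite !mulmxA mxtrace_mulC !mulmxA.
rewrite Re_tr_funmx.
set P := spectralmx X; set Q := spectralmx A; pose V := Q *m U *m P^t*.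
have VE : V^t* = P *m U^t* *m Q^t* by rewrite !trmxCM trmxCK mulmxA.
have uV : V *m V^t* = 1%:M.
  rewrite VE /V !mulmxA -(mulmxA _ _ P) spectral_unitl mulmx1.
  by rewrite -(mulmxA _ U) uU mulmx1 spectral_unitr.
pose w j i := Normc.normc (V j i) ^+ 2.
have entry j : complex.Re ((Q *m (U *m X *m U^t*) *m Q^t*) j j)
    = \sum_i w j i * eigval X i.
  have -> : Q *m (U *m X *m U^t*) *m Q^t* =
      V *m diag_mx (\row_k (eigval X k)%:C) *m V^t*.
    by rewrite VE; apply: conj_change_basis (spectral_diagonalize hX) _;
       exact: spectral_unitl.
  exact: conj_diag_mx_entry.
under eq_bigr do rewrite entry.
have wr j : \sum_i w j i = 1 by exact: unitarymx_entries_row.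
have wc i : \sum_j w j i = 1 by exact: unitarymx_entries_col.
(* Every term becomes a double sum against [w], so that the inequality can be checked for each pair
   of indices: column sums spread the terms in X, row sums those in A and [d]. *)
have -> : \sum_k eigval X k * ln (eigval X k) =
    \sum_j \sum_i w j i * (eigval X i * ln (eigval X i)).
  by rewrite exchange_big /=; apply: eq_bigr => i _; rewrite -mulr_suml wc mul1r.
have -> : \sum_k eigval X k = \sum_j \sum_i w j i * eigval X i.
  by rewrite exchange_big /=; apply: eq_bigr => i _; rewrite -mulr_suml wc mul1r.
have -> : \sum_k eigval A k = \sum_j \sum_i w j i * eigval A j.
  by apply: eq_bigr => j _; rewrite -mulr_suml wr mul1r.
have -> : N%:R * d = \sum_(j < N) \sum_i w j i * d.
  under eq_bigr do rewrite -mulr_suml wr mul1r.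
  by rewrite sumr_const card_ord mulr_natl.
rewrite -big_split -!sumrB; apply: ler_sum => j _ /=.
rewrite mulr_sumr -big_split -!sumrB; apply: ler_sum => i _ /=.
have Xi := eigval_ge0 i pX; have Aj := eigval_ge0 j pA.
have w0 : 0 <= w j i by rewrite sqr_ge0.
have := xlnx_tangent Xi (ltr_wpDl Aj d0).
move=> /(ler_wpM2l w0); rewrite !mulrBr; lra.
Qed.

(** Monotonicity of [ln] at each eigenvalue. Klein's inequality with X = A gives the converse up to
    N d, so the regularized trace is within N d of the negentropy. *)
Lemma negentropy_regularized A (d : R) : psdmx A -> 0 < d ->
  negentropy A <= complex.Re (\tr (A *m funmx (fun x => ln (x + d)) A)).
Proof.
move=> pA d0; have hA := psd_herm pA; rewrite negentropyE //.
rewrite -{3}(funmx_id hA) funmxM Re_tr_funmxl; apply: ler_sum => k _.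
have := eigval_ge0 k pA; rewrite le_eqVlt => /predU1P[<-|a0].
  by rewrite !mul0r.
by rewrite ler_pM2l // ler_ln ?posrE ?addr_gt0 // lerDl ltW.
Qed.

(** The eigenbasis chosen for U X U* is unrelated to the one chosen for X, so the spectra are not
    matched directly. Klein's inequality with A = U X U* tests X against U* log(A + d) U, and
    cyclicity turns this into the regularized negentropy of A; then d tends to 0. *)
Lemma negentropy_unitary X U : psdmx X -> U *m U^t* = 1%:M ->
  negentropy (U *m X *m U^t*) <= negentropy X.
Proof.
move=> pX uU; have pY : psdmx (U *m X *m U^t*).
  by rewrite -{1}(trmxCK U); apply: psd_conj.
apply/ler_addgt0Pr => e e0; have d0 : 0 < e / N.+1%:R by rewrite divr_gt0.
have := klein_inequality pX pY uU d0; have := negentropy_regularized pY d0.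
have -> F : \tr (X *m (U^t* *m F *m U)) = \tr (U *m X *m U^t* *m F).
  by rewrite !mulmxA mxtrace_mulC !mulmxA.
have -> : \tr (U *m X *m U^t*) = \tr X.
  by rewrite -mulmxA mxtrace_mulC -mulmxA (mulmx1C uU) mulmx1.
have : N%:R * (e / N.+1%:R) <= e.
  by rewrite mulrCA ger_pMr // ler_pdivrMr // mul1r ler_nat.
have combine (a b x y z : R) : z <= e -> a <= b -> b + x - x - z <= y -> a <= y + e.
  by move=> ? ? ?; lra.
exact: combine.
Qed.

End Entropy.

(** * Matrix norms *)

Section EntrywiseNorm.
Variable R : realType.

(** The entrywise l1 norm serves for all error estimates: it is submultiplicative and dominates both
    entries and trace. It gives the identity norm n, whence the powers of N in later constants. *)
Definition nrm m n (A : 'M[R[i]]_(m, n)) : R :=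
  \sum_i \sum_j Normc.normc (A i j).

Lemma nrm_ge0 m n (A : 'M[R[i]]_(m, n)) : 0 <= nrm A.
Proof. by rewrite !sumr_ge0 // => i _; rewrite sumr_ge0 // => j _; exact: normc_ge0. Qed.

Lemma nrmD m n (A B : 'M[R[i]]_(m, n)) : nrm (A + B) <= nrm A + nrm B.
Proof.
rewrite /nrm -big_split; apply: ler_sum => i _; rewrite -big_split.
by apply: ler_sum => j _; rewrite mxE; exact: (@le_normcD _ (A i j)).
Qed.

Lemma nrmZ m n (a : R[i]) (A : 'M[R[i]]_(m, n)) :
  nrm (a *: A) = Normc.normc a * nrm A.
Proof.
rewrite /nrm mulr_sumr; apply: eq_bigr => i _; rewrite mulr_sumr.
by apply: eq_bigr => j _; rewrite mxE Normc.normcM.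
Qed.

Lemma nrmN m n (A : 'M[R[i]]_(m, n)) : nrm (- A) = nrm A.
Proof.
by apply: eq_bigr => i _; apply: eq_bigr => j _; rewrite mxE; exact: (@normcN _ (A i j)).
Qed.

Lemma nrmB m n (A B : 'M[R[i]]_(m, n)) : nrm (A - B) <= nrm A + nrm B.
Proof. by rewrite -(nrmN B) nrmD. Qed.

Lemma nrmBC m n (A B : 'M[R[i]]_(m, n)) : nrm (A - B) = nrm (B - A).
Proof. by rewrite -nrmN opprB. Qed.

Lemma nrm0 m n : nrm (0 : 'M[R[i]]_(m, n)) = 0.
Proof. by rewrite -(scale0r 0) nrmZ Normc.normc0 mul0r. Qed.

Lemma nrm1 n : nrm (1%:M : 'M[R[i]]_n) = n%:R.
Proof.
rewrite /nrm -[RHS]mulr1 -[n in RHS]card_ord mulr_natl -sumr_const.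
apply: eq_bigr => i _.
rewrite (bigD1 i) //= mxE eqxx mulr1n Normc.normc1 big1 ?addr0 // => j ji.
by rewrite mxE eq_sym (negPf ji) Normc.normc0.
Qed.

Lemma nrm_sum m n I (r : seq I) (P : pred I) (F : I -> 'M[R[i]]_(m, n)) :
  nrm (\sum_(i <- r | P i) F i) <= \sum_(i <- r | P i) nrm (F i).
Proof.
elim/big_ind2: _ => //; first by rewrite nrm0.
by move=> A a B b Aa Bb; rewrite (le_trans (nrmD _ _)) ?lerD.
Qed.

Lemma normc_le_nrm m n (A : 'M[R[i]]_(m, n)) i j : Normc.normc (A i j) <= nrm A.
Proof.
rewrite /nrm (bigD1 i) //= (bigD1 j) //= -addrA lerDl addr_ge0 ?sumr_ge0 //.
  by move=> k _; exact: normc_ge0.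
by move=> k _; rewrite sumr_ge0 // => l _; exact: normc_ge0.
Qed.

Lemma nrmM m n p (A : 'M[R[i]]_(m, n)) (B : 'M[R[i]]_(n, p)) :
  nrm (A *m B) <= nrm A * nrm B.
Proof.
apply: (@le_trans _ _ (\sum_i \sum_k \sum_j Normc.normc (A i j) * Normc.normc (B j k))).
  apply: ler_sum => i _; apply: ler_sum => k _; rewrite mxE.
  apply: le_trans (normc_sum _ _ _) _.
  by apply: ler_sum => j _; rewrite Normc.normcM.
rewrite /nrm mulr_suml; apply: ler_sum => i _; rewrite exchange_big /= mulr_suml.
apply: ler_sum => j _; rewrite -mulr_sumr ler_wpM2l ?normc_ge0 //.
rewrite (bigD1 j) //= lerDl sumr_ge0 // => k _.
by rewrite sumr_ge0 // => l _; exact: normc_ge0.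
Qed.

Lemma nrm_adj m n (A : 'M[R[i]]_(m, n)) : nrm (A^t*) = nrm A.
Proof.
rewrite /nrm exchange_big; apply: eq_bigr => i _; apply: eq_bigr => j _.
by rewrite !mxE; exact: normc_conj.
Qed.

Lemma normc_tr_le_nrm n (A : 'M[R[i]]_n) : Normc.normc (\tr A) <= nrm A.
Proof.
apply: le_trans (normc_sum _ _ _) _.
apply: ler_sum => i _; rewrite (bigD1 i) //= lerDl sumr_ge0 // => j _.
exact: normc_ge0.
Qed.

Lemma Re_tr_le_nrm n (A : 'M[R[i]]_n) : `|complex.Re (\tr A)| <= nrm A.
Proof. exact: le_trans (Rec_le_normc _) (normc_tr_le_nrm _). Qed.

End EntrywiseNorm.

(** * Euclidean norm, Cauchy-Schwarz and the operator norm *)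

Section OperatorNorm.
Variables (R : realType) (N : nat).
Implicit Types (v w : 'cV[R[i]]_N) (A B K S : 'M[R[i]]_N).

Lemma l2norm_ge0 v : 0 <= l2norm v.
Proof. exact: sqrtr_ge0. Qed.

Lemma sqr_l2norm v : l2norm v ^+ 2 = \sum_k Normc.normc (v k 0) ^+ 2.
Proof. by rewrite sqr_sqrtr // sumr_ge0 // => k _; rewrite sqr_ge0. Qed.

Lemma sqr_l2norm_dot v : l2norm v ^+ 2 = complex.Re ((v^t* *m v) 0 0).
Proof.
rewrite sqr_l2norm mxE Rec_sum; apply: eq_bigr => k _.
by rewrite !mxE mul_conjC_normc.
Qed.

Lemma l2normZ (a : R[i]) v : l2norm (a *: v) = Normc.normc a * l2norm v.
Proof.
rewrite /l2norm -[Normc.normc a]ger0_norm ?normc_ge0 // -sqrtr_sqr.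
rewrite -sqrtrM ?sqr_ge0 // mulr_sumr; congr Num.sqrt; apply: eq_bigr => k _.
by rewrite mxE Normc.normcM exprMn.
Qed.

Lemma normc_le_l2norm v k : Normc.normc (v k 0) <= l2norm v.
Proof.
rewrite -(@ler_pXn2r _ 2) ?nnegrE ?l2norm_ge0 ?normc_ge0 // sqr_l2norm.
by rewrite (bigD1 k) //= lerDl sumr_ge0 // => j _; rewrite sqr_ge0.
Qed.

Lemma nrm_le_l2norm v : nrm v <= N%:R * l2norm v.
Proof.
rewrite /nrm -[N in N%:R]card_ord mulr_natl -sumr_const; apply: ler_sum => i _.
by rewrite big_ord1 normc_le_l2norm.
Qed.

Lemma l2norm_le_nrm v : l2norm v <= nrm v.
Proof.
have -> : nrm v = \sum_k Normc.normc (v k 0).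
  by apply: eq_bigr => k _; rewrite big_ord1.
have s0 : 0 <= \sum_k Normc.normc (v k 0).
  by rewrite sumr_ge0 // => k _; exact: normc_ge0.
rewrite -(@ler_pXn2r _ 2) ?nnegrE ?l2norm_ge0 // sqr_l2norm expr2 mulr_suml.
apply: ler_sum => k _; rewrite expr2 ler_wpM2l ?normc_ge0 //.
by rewrite (bigD1 k) //= lerDl sumr_ge0 // => j _; exact: normc_ge0.
Qed.

Lemma l2norm_eq0 v : l2norm v = 0 -> v = 0.
Proof.
move=> v0; apply/colP => k; rewrite mxE; apply: Normc.eq0_normc; apply/eqP.
by rewrite eq_le normc_ge0 andbT -v0 normc_le_l2norm.
Qed.

Lemma cauchy_schwarz v w : complex.Re ((v^t* *m w) 0 0) <= l2norm v * l2norm w.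
Proof.
have [/l2norm_eq0 ->|v0] := eqVneq (l2norm v) 0.
  by rewrite trmx0 map_mx0 mul0mx mxE mulr_ge0 ?l2norm_ge0.
have [/l2norm_eq0 ->|w0] := eqVneq (l2norm w) 0.
  by rewrite mulmx0 mxE mulr_ge0 ?l2norm_ge0.
have vp : 0 < l2norm v by rewrite lt_def v0 l2norm_ge0.
have wp : 0 < l2norm w by rewrite lt_def w0 l2norm_ge0.
(* The weights |w| / |v| and |v| / |w| make both halves of the sum equal to |v| |w| / 2; the claim
   then holds term by term, by the arithmetic-geometric mean inequality. *)
have : l2norm v * l2norm w = \sum_k
    (l2norm w / l2norm v * Normc.normc (v k 0) ^+ 2
     + l2norm v / l2norm w * Normc.normc (w k 0) ^+ 2) / 2.
  rewrite -mulr_suml big_split /= -!mulr_sumr -!sqr_l2norm.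
  by field; rewrite ?v0 ?w0.
move=> ->; rewrite mxE Rec_sum; apply: ler_sum => k _.
apply: le_trans (ler_norm _) _; apply: le_trans (Rec_le_normc _) _.
rewrite !mxE Normc.normcM normc_conj.
set a := Normc.normc _; set b := Normc.normc _.
have : 0 <= (l2norm w * a - l2norm v * b) ^+ 2 / (l2norm v * l2norm w).
  by rewrite divr_ge0 ?sqr_ge0 ?mulr_ge0 ?l2norm_ge0.
have -> : (l2norm w * a - l2norm v * b) ^+ 2 / (l2norm v * l2norm w) =
  l2norm w / l2norm v * a ^+ 2 + l2norm v / l2norm w * b ^+ 2 - 2 * (a * b).
  by field; rewrite ?v0 ?w0.
lra.
Qed.

Lemma l2normD v w : l2norm (v + w) <= l2norm v + l2norm w.
Proof.
have d0 : 0 <= l2norm v + l2norm w by rewrite addr_ge0 ?l2norm_ge0.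
have [->|e0] := eqVneq (l2norm (v + w)) 0; first by [].
have ep : 0 < l2norm (v + w) by rewrite lt_def e0 l2norm_ge0.
rewrite -(ler_pM2l ep) -expr2 sqr_l2norm_dot mulmxDr mxE RecD mulrDr.
by rewrite lerD ?cauchy_schwarz.
Qed.

(** Required before any use of [opnorm], since [sup] is a least upper bound only for a nonempty
    bounded set. *)
Lemma opnorm_has_sup A :
  has_sup [set l2norm (A *m v) | v in [set v | l2norm v <= 1]].
Proof.
split; first by exists (l2norm (A *m 0)), 0 => //=; rewrite (le_trans (l2norm_le_nrm _)) // nrm0.
exists (nrm A * N%:R) => _ [v /= v1 <-].
apply: le_trans (l2norm_le_nrm _) _; apply: le_trans (nrmM _ _) _.
rewrite ler_wpM2l ?nrm_ge0 //; apply: le_trans (nrm_le_l2norm _) _.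
by rewrite ler_piMr.
Qed.

Lemma opnorm_ub A v : l2norm v <= 1 -> l2norm (A *m v) <= opnorm A.
Proof. by move=> v1; apply: sup_upper_bound (opnorm_has_sup A) _ _; exists v. Qed.

Lemma opnorm_ge0 A : 0 <= opnorm A.
Proof.
apply: le_trans (opnorm_ub A (_ : l2norm 0 <= 1)); first exact: l2norm_ge0.
by rewrite (le_trans (l2norm_le_nrm _)) // nrm0.
Qed.

Lemma opnorm_mulmx A v : l2norm (A *m v) <= opnorm A * l2norm v.
Proof.
have [v0|v0] := eqVneq (l2norm v) 0.
  by rewrite (l2norm_eq0 v0) mulmx0 (le_trans (l2norm_le_nrm _)) // nrm0 mulr_ge0 ?opnorm_ge0 ?l2norm_ge0.
have vp : 0 < l2norm v by rewrite lt_def v0 l2norm_ge0.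
have := @opnorm_ub A ((l2norm v)^-1%:C *: v).
rewrite -scalemxAr !l2normZ normc_real ger0_norm ?invr_ge0 ?l2norm_ge0 //.
by rewrite mulVf // ler_pdivrMl // mulrC => ->.
Qed.

Lemma opnorm_lipschitz A B : opnorm A <= opnorm B + nrm (A - B) * N%:R.
Proof.
apply: ge_sup; first exact: (opnorm_has_sup A).1.
move=> _ [v /= v1 <-]; have -> : A *m v = B *m v + (A - B) *m v by rewrite -mulmxDl subrKC.
apply: le_trans (l2normD _ _) _; apply: lerD; first exact: opnorm_ub.
apply: le_trans (l2norm_le_nrm _) _; apply: le_trans (nrmM _ _) _.
rewrite ler_wpM2l ?nrm_ge0 //; apply: le_trans (nrm_le_l2norm _) _.
by rewrite ler_piMr.
Qed.

(** The trace of S* K S is the sum of the forms of K at the columns of S, to each of which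
    Cauchy-Schwarz applies; the factor i has modulus 1. *)
Lemma quad_form_opnorm K S :
  complex.Re ('i * \tr (S^t* *m K *m S))
    <= opnorm K * complex.Re (\tr (S^t* *m S)).
Proof.
rewrite mulr_sumr !Rec_sum mulr_sumr; apply: ler_sum => k _.
have -> : (S^t* *m S) k k = ((col k S)^t* *m col k S) 0 0.
  by rewrite !mxE; apply: eq_bigr => l _; rewrite !mxE.
have -> : 'i * (S^t* *m K *m S) k k =
    ((col k S)^t* *m ('i *: (K *m col k S))) 0 0.
  have -> : K *m col k S = col k (K *m S) by rewrite !colE mulmxA.
  rewrite -scalemxAr [RHS]mxE -mulmxA; congr (_ * _).
  by rewrite !mxE; apply: eq_bigr => l _; rewrite !mxE.
rewrite -sqr_l2norm_dot; apply: le_trans (cauchy_schwarz _ _) _.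
rewrite l2normZ normc_i mul1r expr2 mulrCA ler_wpM2l ?l2norm_ge0 //.
exact: opnorm_mulmx.
Qed.

(** With X = S S*, cyclicity of the trace reduces both sides to quadratic forms at the columns of G
    S. *)
Lemma psd_opnorm X G K : psdmx X -> G^t* = G ->
  complex.Re ('i * \tr (X *m (G *m K *m G)))
    <= opnorm K * complex.Re (\tr (X *m (G *m G))).
Proof.
move=> /psd_factor[S ->] hG; have := quad_form_opnorm K (G *m S).
have -> : \tr (S *m S^t* *m (G *m K *m G)) = \tr ((G *m S)^t* *m K *m (G *m S)).
  by rewrite trmxCM hG -mulmxA mxtrace_mulC !mulmxA.
have -> : \tr (S *m S^t* *m (G *m G)) = \tr ((G *m S)^t* *m (G *m S)).
  by rewrite trmxCM hG -mulmxA mxtrace_mulC !mulmxA.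
by [].
Qed.

End OperatorNorm.

(** * The commutator with log sigma *)

Section CommutatorWithLogarithm.
Variables (R : realType) (N : nat).
Local Notation M := 'M[R[i]]_N.
Implicit Types (A X H : M) (f g : R -> R).

Lemma is_derive_sumr n (h : 'I_n -> R -> R) (dh : 'I_n -> R) (x : R) :
  (forall k, is_derive x 1 (h k) (dh k)) ->
  is_derive x 1 (fun y => \sum_k h k y) (\sum_k dh k).
Proof.
move=> /is_derive_sum; rewrite (_ : (fun y => _) = \sum_k h k) //.
by apply/funext => y; rewrite fct_sumE.
Qed.

Lemma is_derive_log_resolvent (s c e x : R) : 0 < s + x ->
  is_derive x 1 (fun y => c * ln (s + y) - e * (s + y)^-1)
    (c * (s + x)^-1 + e * (s + x) ^- 2).
Proof.
move=> sx.
have d1 : is_derive x 1 (fun y => s + y) 1.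
  by have := is_deriveD (is_derive_cst s x 1) (is_derive_id x 1); rewrite add0r.
have d2 : is_derive x 1 (fun y => ln (s + y)) (s + x)^-1.
  rewrite -[X in is_derive _ _ _ X]mulr1.
  exact: (@is_derive1_comp _ (@ln R) (fun y => s + y) x (s + x)^-1 1 (is_derive1_ln sx) d1).
have d3 : is_derive x 1 (fun y => (s + y)^-1) (- (s + x) ^- 2).
  have := @is_deriveV _ (fun y => s + y) x 1 1 _ d1.
  by rewrite gt_eqF // => /(_ isT); rewrite scaler1.
have := is_deriveB (is_deriveZ c d2) (is_deriveZ e d3).
by rewrite /GRing.scale /= mulrN opprK.
Qed.

(* The hypothesis says that [sum c ln (s + x) - K sum d s / (s + x)] is
   nondecreasing in [x]; as [sum c = 0], it tends to [0] at infinity. *)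
Lemma ln_le_of_resolvent_le (s c d : 'I_N -> R) (K : R) :
  (forall k, 0 < s k) -> \sum_k c k = 0 ->
  (forall x : R, 0 <= x -> 0 <= \sum_k c k * (s k + x)^-1
     + K * \sum_k d k * (s k * (s k + x) ^- 2)) ->
  \sum_k c k * ln (s k) <= K * \sum_k d k.
Proof.
move=> s0 c0 H.
pose F x := \sum_k (c k * ln (s k + x) - K * (d k * s k) * (s k + x)^-1).
pose F' x := \sum_k (c k * (s k + x)^-1 + K * (d k * s k) * (s k + x) ^- 2).
have dF (x : R) : 0 <= x -> is_derive x 1 F (F' x).
  by move=> x0; apply: is_derive_sumr => k; apply: is_derive_log_resolvent; rewrite ltr_wpDr.
have F'0 x : 0 <= x -> 0 <= F' x.
  move=> /H; rewrite /F' big_split /= mulr_sumr; congr (0 <= _ + _).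
  by apply: eq_bigr => k _; rewrite !mulrA.
have FF x : 0 < x -> F 0 <= F x.
  move=> x0; have [||y] := @MVT _ F F' 0 x x0.
  - by move=> y; rewrite in_itv /= => /andP[y0 _]; apply: dF; exact: ltW.
  - apply: derivable_within_continuous => y; rewrite in_itv /= => /andP[y0 _].
    by have [] := dF _ y0.
  rewrite in_itv /= => /andP[y0 _] e.
  by rewrite -subr_ge0 e subr0; apply: mulr_ge0; [apply: F'0; exact: ltW|exact: ltW].
pose B := \sum_k (`|c k| * s k + `|K * (d k * s k)|).
have FB x : 0 < x -> F x <= B / x.
  move=> x0.
  have -> : F x = \sum_k (c k * ln (1 + s k / x) - K * (d k * s k) * (s k + x)^-1).
    rewrite /F !sumrB; congr (_ - _).
    (* As the [c k] sum to 0, subtracting ln x from every logarithm changes nothing; ln (1 + s / x)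
       <= s / x then yields decay of order 1 / x. *)
    have -> : \sum_k c k * ln (1 + s k / x) = \sum_k c k * ln (s k + x) - (\sum_k c k) * ln x.
      rewrite mulr_suml -sumrB; apply: eq_bigr => k _.
      rewrite -mulrBr -ln_div ?posrE ?addr_gt0 // mulrDl divff ?gt_eqF //.
      by rewrite addrC.
    by rewrite c0 mul0r subr0.
  rewrite mulr_suml; apply: ler_sum => k _; rewrite mulrDl.
  have sx : 0 < s k / x by rewrite divr_gt0.
  have lnx : 0 <= ln (1 + s k / x) by rewrite ln_ge0 // lerDl ltW.
  apply: lerD.
    apply: le_trans (ler_norm _) _; rewrite normrM -mulrA ler_wpM2l //.
    by rewrite ger0_norm // le_ln1Dx // (lt_trans _ sx) // ltrN10.
  apply: le_trans (ler_norm _) _; rewrite normrN normrM ler_wpM2l //.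
  by rewrite ger0_norm ?invr_ge0 ?addr_ge0 ?ltW // ltf_pV2 ?posrE ?addr_gt0 // ltrDr.
rewrite -subr_le0; have -> : \sum_k c k * ln (s k) - K * \sum_k d k = F 0.
  rewrite /F sumrB mulr_sumr; congr (_ - _); apply: eq_bigr => k _.
    by rewrite addr0.
  by rewrite addr0 -mulrA mulfK // gt_eqF.
rewrite leNgt; apply/negP => F0.
have B0 : 0 <= B by rewrite sumr_ge0 // => k _; rewrite addr_ge0 // mulr_ge0 // ltW.
(* At this point F 0 <= F x <= B / x becomes F 0 <= B F 0 / (B + 1), absurd when F 0 > 0. *)
have x0 : 0 < (B + 1) / F 0 by rewrite divr_gt0 // ltr_wpDl.
have := le_trans (FF _ x0) (FB _ x0).
rewrite invf_div mulrA ler_pdivlMr ?ltr_wpDl // [leRHS]mulrC ler_pM2l //.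
lra.
Qed.

Lemma funmx_shift A (x : R) : A^t* = A ->
  funmx (fun y => y + x) A = A + x%:C%:M.
Proof.
move=> hA; rewrite -{2}(funmx_id hA) !funmxE.
have -> : diag_mx (\row_k (eigval A k + x)%:C)
    = diag_mx (\row_k (id (eigval A k))%:C) + x%:C%:M.
  rewrite -diag_const_mx -linearD; congr diag_mx.
  by apply/rowP => k; rewrite !mxE rmorphD.
rewrite mulmxDr mulmxDl; congr (_ + _).
by rewrite scalar_mxC -mulmxA spectral_unitl mulmx1.
Qed.

(** Cyclicity moves the commutator onto X, so that for A = f(sigma) only the diagonal of [X, H] in
    an eigenbasis of sigma matters. *)
Lemma tr_mul_commutator X H A :
  \tr (X *m commutator H A) = \tr ((X *m H - H *m X) *m A).
Proof.
rewrite /commutator mulmxBr mulmxBl !linearB /= mulmxA; congr (_ - _).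
by rewrite -(mulmxA H) [RHS]mxtrace_mulC mulmxA.
Qed.

Lemma mulmx_regroup (G I C Q : M) : G *m I = Q -> I *m G = Q ->
  G *m (I *m C *m I) *m G = Q *m C *m Q.
Proof. by move=> e1 e2; rewrite !mulmxA e1 -(mulmxA _ I G) e2. Qed.

Lemma commutator_resolvent A H (Q : M) : Q *m A = 1%:M -> A *m Q = 1%:M ->
  commutator H Q = - (Q *m commutator H A *m Q).
Proof.
move=> QA AQ; rewrite /commutator mulmxBr mulmxBl opprB !mulmxA QA mul1mx.
by rewrite -(mulmxA _ A Q) AQ mulmx1.
Qed.

(* Let [K] be the argument of [opnorm] and [G = sigma^(1/2) (sigma + x)^-1]. The
   derivative in [x] of the commutator of [H] with [log (sigma + x)] is its
   commutator with [(sigma + x)^-1], that is [- G K G], and the trace of the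
   latter against [X] is at most [opnorm K] times [tr (X sigma (sigma + x)^-2)],
   the derivative of [- tr (X sigma (sigma + x)^-1)]. *)
Lemma commutator_logmx_le (sigma X H : M) :
  psdmx sigma -> \rank sigma = N -> state X ->
  complex.Re ('i * \tr (X *m commutator H (logmx sigma)))
    <= opnorm (invsqrtmx sigma *m commutator H sigma *m invsqrtmx sigma).
Proof.
move=> ps rs [pX tX]; set K := (X in opnorm X); set s := eigval sigma.
have s0 k : 0 < s k by exact: eigval_gt0.
pose coef (Z : M) k := complex.Re ((spectralmx sigma *m Z *m (spectralmx sigma)^t*) k k).
pose c := coef ('i *: (X *m H - H *m X)); pose d := coef X.
(* Both traces are linear in f(sigma): the matrix inequality becomes one between sums over the
   eigenvalues of sigma, with coefficients [c] and [d]. *)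
have phiE f : complex.Re ('i * \tr (X *m commutator H (funmx f sigma)))
    = \sum_k c k * f (s k).
  rewrite tr_mul_commutator -mxtraceZ scalemxAl Re_tr_funmx.
  by apply: eq_bigr => k _; rewrite mulrC.
have trE f : complex.Re (\tr (X *m funmx f sigma)) = \sum_k d k * f (s k).
  by rewrite Re_tr_funmx; apply: eq_bigr => k _; rewrite mulrC.
(* The constant function 1 gives both normalizations: the identity commutes with H, and X has trace
   1. *)
have c0 : \sum_k c k = 0.
  transitivity (\sum_k c k * (fun=> 1) (s k)).
    by apply: eq_bigr => k _; rewrite mulr1.
  by rewrite -(phiE (fun=> 1)) funmx1 /commutator mulmx1 mul1mx subrr mulmx0 mxtrace0 mulr0.
have d1 : \sum_k d k = 1.
  transitivity (\sum_k d k * (fun=> 1) (s k)).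
    by apply: eq_bigr => k _; rewrite mulr1.
  by rewrite -(trE (fun=> 1)) funmx1 mulmx1 tX.
rewrite /logmx phiE -[leRHS]mulr1 -d1; apply: ln_le_of_resolvent_le => // x x0.
have sx k : 0 < s k + x by rewrite ltr_wpDr.
rewrite -(phiE (fun y => (y + x)^-1)) -(trE (fun y => y * (y + x) ^- 2)).
set Q := funmx (fun y => (y + x)^-1) sigma.
pose G := funmx (fun y => Num.sqrt y * (y + x)^-1) sigma.
have GG : G *m G = funmx (fun y => y * (y + x) ^- 2) sigma.
  rewrite funmxM; apply: funmx_eq => k; rewrite -/(s k) mulrACA -expr2 sqr_sqrtr ?ltW //.
  by rewrite -exprVn.
have Q1 : Q *m funmx (fun y => y + x) sigma = 1%:M.
  by rewrite funmxM -(funmx1 sigma); apply: funmx_eq => k; rewrite mulVf // gt_eqF.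
have Q2 : funmx (fun y => y + x) sigma *m Q = 1%:M.
  by rewrite funmxM -(funmx1 sigma); apply: funmx_eq => k; rewrite divff // gt_eqF.
have cE : commutator H (funmx (fun y => y + x) sigma) = commutator H sigma.
  rewrite (funmx_shift _ (psd_herm ps)) /commutator mulmxDr mulmxDl scalar_mxC.
  by rewrite opprD addrACA subrr addr0.
(* The factor sigma^(1/2) in [G] cancels the sigma^(-1/2) on each side of [K] and leaves the
   resolvent [Q]. *)
have GK : G *m K *m G = Q *m commutator H sigma *m Q.
  have e1 : G *m invsqrtmx sigma = Q.
    rewrite funmxM; apply: funmx_eq => k.
    by rewrite mulrAC divff ?mul1r // gt_eqF // sqrtr_gt0.
  have e2 : invsqrtmx sigma *m G = Q.
    rewrite funmxM; apply: funmx_eq => k.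
    by rewrite mulrA mulVf ?mul1r // gt_eqF // sqrtr_gt0.
  exact: mulmx_regroup.
rewrite (commutator_resolvent _ Q1 Q2) cE -GK -GG.
have := psd_opnorm K pX (funmx_adj _ _ : G^t* = G).
rewrite mulmxN raddfN mulrN RecN; lra.
Qed.

End CommutatorWithLogarithm.

(** * One step of the product formula *)

Section OneStep.
Variables (R : realType) (N : nat).
Local Notation M := 'M[R[i]]_N.
Implicit Types (A H X Y Z U : M).

(** For h <= 1 every term after the first two carries a factor h^2, and what remains sums to at most
    m e^C. The same domination gives convergence of the series, without which [limn] would mean
    nothing. *)
Lemma lim_series_second_order (a : R^nat) (h C m : R) :
  0 <= h <= 1 -> 0 <= C -> 0 <= m ->
  (forall k, `|a k| <= m * (h ^+ k * exp_coeff C k)) ->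
  `|limn (series a) - (a 0%N + a 1%N)| <= h ^+ 2 * (m * expR C).
Proof.
move=> /andP[h0 h1] C0 m0 ale.
have e0 k : 0 <= exp_coeff C k by rewrite /exp_coeff /= divr_ge0 ?exprn_ge0.
have ale' k : `|a k| <= (m *: exp_coeff C) k.
  apply: le_trans (ale k) _; rewrite ler_wpM2l //.
  by rewrite ler_piMl // exprn_ile1.
have cvga : cvgn (series a).
  apply: normed_cvg; apply: (series_le_cvg _ _ ale') => [k|k|] //.
    by rewrite mulr_ge0.
  exact/is_cvg_seriesZ/is_cvg_series_exp_coeff.
have ub n : series (exp_coeff C) n <= expR C.
  apply: nondecreasing_cvgn_le; last exact: is_cvg_series_exp_coeff.
  by apply/nondecreasing_seqP => k; rewrite !seriesEnat /= big_nat_recr //= lerDl.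
set c := a 0%N + a 1%N.
have cv : `|series a n - c| @[n --> \oo] --> `|limn (series a) - c|.
  by apply: cvg_norm; apply: cvgB => //; exact: cvg_cst.
rewrite -(cvg_lim _ cv) //; apply: limr_le; first exact: cvgP cv.
exists 2%N => // -[//|[//|n]] _ /=.
rewrite seriesEnat /= !big_nat_recl // -/c addrA [X in `|X|]addrAC subrr add0r.
apply: le_trans (ler_norm_sum _ _ _) _.
apply: (@le_trans _ _ (\sum_(0 <= k < n) h ^+ 2 * (m * exp_coeff C k.+2))).
  apply: ler_sum_nat => k _; apply: le_trans (ale _) _.
  rewrite [leRHS]mulrCA ler_wpM2l // ler_wpM2r ?e0 //.
  by rewrite -addn2 exprD ler_piMl ?exprn_ile1 ?exprn_ge0.
rewrite -!mulr_sumr ler_wpM2l ?exprn_ge0 // ler_wpM2l //.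
apply: le_trans (ub n.+2); rewrite seriesEnat /= !big_nat_recl //.
by rewrite addrA lerDr addr_ge0.
Qed.

Lemma linear_bounded (L : {linear M -> M}) :
  exists2 C : R, 0 <= C & forall X, nrm (L X) <= C * nrm X.
Proof.
exists (\sum_i \sum_j nrm (L (delta_mx i j))).
  by rewrite !sumr_ge0 // => i _; rewrite sumr_ge0 // => j _; exact: nrm_ge0.
move=> X; rewrite {1}[X]matrix_sum_delta linear_sum.
apply: le_trans (nrm_sum _ _ _) _; rewrite mulr_suml; apply: ler_sum => i _.
rewrite linear_sum; apply: le_trans (nrm_sum _ _ _) _.
rewrite mulr_suml; apply: ler_sum => j _.
by rewrite linearZ nrmZ mulrC ler_wpM2l ?nrm_ge0 ?normc_le_nrm.
Qed.

Lemma iter_bounded (L : {linear M -> M}) (C : R) : 0 <= C ->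
  (forall X, nrm (L X) <= C * nrm X) ->
  forall k X, nrm (iter k L X) <= C ^+ k * nrm X.
Proof.
move=> C0 LC; elim=> [|k IH] X; first by rewrite expr0 mul1r.
rewrite iterS exprS -mulrA; apply: le_trans (LC _) _.
by rewrite ler_wpM2l.
Qed.

(* [2 *: W - 1] is the Cayley transform [(1 + iA) (1 - iA)^-1]. *)
Lemma cayley_unitary A (W : M) : A^t* = A ->
  (1%:M - 'i *: A) *m W = 1%:M ->
  (2 *: W - 1%:M) *m (2 *: W - 1%:M)^t* = 1%:M.
Proof.
move=> hA MW; have WM := mulmx1C MW.
have hW : W^t* *m (1%:M + 'i *: A) = 1%:M.
  have := congr1 (fun X : M => X^t*) MW.
  rewrite trmxCM trmxCB trmxC1 trmxCZ hA.
  have -> : conjc 'i = - 'i :> R[i].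
    by apply/eqP; rewrite eq_complex /= oppr0 !eqxx.
  by rewrite scaleNr opprK.
(* This is unitarity of 2 W - 1 after expansion. It follows by inserting (1 - iA) + (1 + iA) = 2
   between W and W*, each summand cancelling one factor. *)
have sumW : W + W^t* = 2 *: (W *m W^t*).
  have -> : 2 *: (W *m W^t*) = W *m ((1%:M - 'i *: A) + (1%:M + 'i *: A)) *m W^t*.
    by rewrite addrACA addNr addr0 mulmxDr mulmx1 mulmxDl scaler_nat mulr2n.
  by rewrite mulmxDr mulmxDl WM mul1mx -mulmxA (mulmx1C hW) mulmx1 addrC.
rewrite trmxCB trmxCZ trmxC1 mulmxBl mul1mx mulmxBr mulmx1 -scalemxAl -scalemxAr.
have -> : conjc (2 : R[i]) = 2 by exact: conjc_nat.
by rewrite -sumW opprB scalerDr [X in X - _ + _]addrC addrK subrKC.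
Qed.

(** A row v killed by 1 - iA satisfies v = i v A, hence nrm v <= nrm v / 2. The same half absorbs
    nrm W in W = 1 + i A W, leaving twice the norm of the identity. *)
Lemma cayley_exists A : nrm A <= 2^-1 -> exists2 W : M,
  (1%:M - 'i *: A) *m W = 1%:M & nrm W <= 2 * N%:R.
Proof.
move=> A2; have uM : (1%:M - 'i *: A) \in unitmx.
  rewrite -row_free_unit; apply: inj_row_free => v /eqP.
  rewrite mulmxBr mulmx1 subr_eq0 => /eqP vE.
  have : nrm v <= nrm v * 2^-1.
    rewrite {1}vE; apply: le_trans (nrmM _ _) _.
    by rewrite ler_wpM2l ?nrm_ge0 // nrmZ normc_i mul1r.
  have := nrm_ge0 v; move=> v0 v2.
  apply/rowP => k; rewrite mxE; apply: Normc.eq0_normc; apply/eqP.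
  rewrite eq_le normc_ge0 andbT; have := normc_le_nrm v 0 k; lra.
exists (invmx (1%:M - 'i *: A)); first exact: mulmxV.
set W := invmx _; have /eqP : (1%:M - 'i *: A) *m W = 1%:M by exact: mulmxV.
rewrite mulmxBl mul1mx subr_eq => /eqP WE.
have : nrm W <= N%:R + 2^-1 * nrm W.
  rewrite {1}WE; apply: le_trans (nrmD _ _) _; rewrite nrm1 lerD2l.
  apply: le_trans (nrmM _ _) _; rewrite ler_wpM2r ?nrm_ge0 //.
  by rewrite nrmZ normc_i mul1r.
lra.
Qed.

(** Factoring X = S S* gives |X_ij| <= (X_ii + X_jj) / 2, and the sum over all i, j is N tr X. This
    makes the one-step constants uniform over states. *)
Lemma state_nrm_le X : state X -> nrm X <= N%:R.
Proof.
move=> [/psd_factor[S XE] tX].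
have XD i : complex.Re (X i i) = \sum_k Normc.normc (S i k) ^+ 2.
  rewrite XE mxE Rec_sum; apply: eq_bigr => k _.
  by rewrite !mxE mulrC mul_conjC_normc.
have trX : \sum_i complex.Re (X i i) = 1 by rewrite -Rec_sum -/(mxtrace X) tX.
have entry i j : Normc.normc (X i j) <= complex.Re (X i i) / 2 + complex.Re (X j j) / 2.
  rewrite !XD XE mxE !mulr_suml -big_split /=.
  apply: le_trans (normc_sum _ _ _) _; apply: ler_sum => k _.
  rewrite !mxE Normc.normcM normc_conj.
  have := sqr_ge0 (Normc.normc (S i k) - Normc.normc (S j k)); rewrite sqrrB; lra.
apply: (@le_trans _ _ (\sum_i \sum_j (complex.Re (X i i) / 2 + complex.Re (X j j) / 2))).
  by apply: ler_sum => i _; apply: ler_sum => j _.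
under eq_bigr do rewrite big_split /= sumr_const card_ord -mulr_suml trX.
rewrite big_split /= sumr_const card_ord -mulrnAl.
rewrite sumrMnl -mulr_suml trX -mulr_natr; lra.
Qed.

(** Meant for U = 1 + K + E and U* = 1 - K + F, with K anti-Hermitian of first order and E, F of
    second: the right-hand side collects what is left after the first-order term. *)
Lemma conj_perturbation (K E F X : M) :
  (1%:M + K + E) *m X *m (1%:M - K + F) - X - (K *m X - X *m K)
  = - (K *m X *m K) + (1%:M + K) *m X *m F
    + E *m X *m (1%:M - K) + E *m X *m F.
Proof.
rewrite (mulmxDl (1%:M + K)) mulmxDl !(mulmxDr _ (1%:M - K)).
have -> : (1%:M + K) *m X *m (1%:M - K) = X + (K *m X - X *m K) - K *m X *m K.
  rewrite mulmxBr mulmx1 mulmxDl mul1mx mulmxDl opprD !addrA.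
  by congr (_ - _); rewrite addrAC.
set a := K *m X - X *m K; set b := K *m X *m K.
set c := (1%:M + K) *m X *m F; set d := E *m X *m _; set e := E *m X *m F.
rewrite !addrA; apply/eqP; rewrite -subr_eq0.
apply/eqP/matrixP => i j; rewrite !mxE; ring.
Qed.

(** With K = 2iA, the 4 comes from K X K, the 8 N (N + 1) from the two terms with a single
    remainder, and the 4 N^2 from the term with both remainders. *)
Definition cayley_const : R := 4 + 8 * N%:R * (N%:R + 1) + 4 * N%:R ^+ 2.

Lemma cayley_step A : A^t* = A -> nrm A <= 2^-1 ->
  exists2 U : M, U *m U^t* = 1%:M & forall X,
    nrm (U *m X *m U^t* - X - (2 * 'i) *: (A *m X - X *m A))
      <= cayley_const * nrm A ^+ 2 * nrm X.
Proof.
move=> hA A2; have [W MW nW] := cayley_exists A2.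
exists (2 *: W - 1%:M); first exact: cayley_unitary MW.
set U := 2 *: W - 1%:M; pose K := (2 * 'i) *: A; pose E := U - (1%:M + K).
have a0 := nrm_ge0 A; have N0 : 0 <= N%:R :> R by [].
(* Iterating W = 1 + i A W once more gives the exact expansion 2 W - 1 = 1 + 2iA - 2 A^2 W. *)
have EE : E = - (2%:R *: (A *m A *m W)).
  have WE : W = 1%:M + 'i *: (A *m W).
    by move/eqP: MW; rewrite mulmxBl mul1mx subr_eq -scalemxAl => /eqP.
  have AW : A *m W = A + 'i *: (A *m A *m W).
    by rewrite {1}WE mulmxDr mulmx1 -scalemxAr mulmxA.
  have WE2 : W = 1%:M + 'i *: A - A *m A *m W.
    rewrite {1}WE AW scalerDr scalerA addrA; congr (_ + _).
    by rewrite -expr2 sqr_i scaleN1r.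
  rewrite /E /U {1}WE2 /K; move: (A *m A *m W) => Z.
  by apply/matrixP => i j; rewrite !mxE; ring.
have n2 : Normc.normc (2 : R[i]) = 2.
  by rewrite -(rmorph_nat (real_complex R)) normc_real ger0_norm.
have nE : nrm E <= 4 * N%:R * nrm A ^+ 2.
  rewrite EE nrmN nrmZ n2.
  have := nrmM (A *m A) W; have := nrmM A A; have := nrm_ge0 (A *m A).
  move=> p0 p1 p2.
  have p3 : nrm (A *m A) * nrm W <= nrm A ^+ 2 * (2 * N%:R).
    by rewrite ler_pM ?nrm_ge0 // expr2.
  lra.
(* In the term with both remainders one of them is bounded by a constant, so that the estimate stays
   quadratic in nrm A. *)
have nE1 : nrm E <= N%:R.
  apply: le_trans nE _.
  have : nrm A ^+ 2 <= 2^-1 ^+ 2 by rewrite lerXn2r ?nnegrE // invr_ge0.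
  move=> /(ler_wpM2l N0); lra.
have nK : nrm K = 2 * nrm A by rewrite nrmZ Normc.normcM n2 normc_i mulr1.
have KC : K^t* = - K.
  rewrite trmxCZ hA -scaleNr; congr (_ *: _); apply/eqP.
  by rewrite eq_complex /=; apply/andP; split; apply/eqP; ring.
have UE : U = 1%:M + K + E by rewrite subrKC.
have UC : U^t* = 1%:M - K + E^t* by rewrite UE !trmxCD trmxC1 KC.
move=> X; have x0 := nrm_ge0 X.
have -> : (2 * 'i) *: (A *m X - X *m A) = K *m X - X *m K.
  by rewrite scalerBr scalemxAl scalemxAr.
rewrite UC {1}UE conj_perturbation.
have bound (P Q : M) (p q : R) : nrm P <= p -> nrm Q <= q ->
    nrm (P *m X *m Q) <= p * nrm X * q.
  move=> Pp Qq; apply: le_trans (nrmM _ _) _; apply: ler_pM; rewrite ?nrm_ge0 //.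
  by apply: le_trans (nrmM _ _) _; rewrite ler_wpM2r.
have n1K : nrm (1%:M + K) <= N%:R + 1.
  by apply: le_trans (nrmD _ _) _; rewrite nrm1 nK lerD2l; lra.
have n1K' : nrm (1%:M - K) <= N%:R + 1.
  by apply: le_trans (nrmB _ _) _; rewrite nrm1 nK lerD2l; lra.
have nEC : nrm (E^t*) <= 4 * N%:R * nrm A ^+ 2 by rewrite nrm_adj.
have b1 := bound K K _ _ (lexx _) (lexx _); rewrite nK in b1.
have b2 := bound _ _ _ _ n1K nEC.
have b3 := bound _ _ _ _ nE n1K'.
have b4 := bound _ _ _ _ nE1 nEC.
apply: (@le_trans _ _ (nrm (K *m X *m K) + nrm ((1%:M + K) *m X *m E^t*)
    + nrm (E *m X *m (1%:M - K)) + nrm (E *m X *m E^t*))).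
  apply: le_trans (nrmD _ _) _; rewrite lerD2r.
  apply: le_trans (nrmD _ _) _; rewrite lerD2r.
  by apply: le_trans (nrmD _ _) _; rewrite lerD2r nrmN.
apply: le_trans (lerD (lerD (lerD b1 b2) b3) b4) _.
by rewrite le_eqVlt; apply/orP; left; apply/eqP; rewrite /cayley_const; ring.
Qed.

(** The series is estimated on real and imaginary parts of each entry, whence the factor 2 N^2. *)
Lemma expop_second_order (L : {linear M -> M}) (C h : R) X : 0 <= C ->
  (forall X, nrm (L X) <= C * nrm X) -> 0 <= h <= 1 ->
  nrm (expop L h X - (X + h%:C *: L X))
    <= h ^+ 2 * (N%:R * N%:R * (2 * (nrm X * expR C))).
Proof.
move=> C0 LC h01; have [h0 h1] := andP h01.
have coefE k i j : ((h ^+ k / k`!%:R)%:C *: iter k L X) i j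
    = (h ^+ k / k`!%:R)%:C * iter k L X i j by rewrite mxE.
have ck k : 0 <= h ^+ k / k`!%:R by rewrite divr_ge0 ?exprn_ge0.
have iterC k i j : Normc.normc (iter k L X i j) * (h ^+ k / k`!%:R)
    <= nrm X * (h ^+ k * exp_coeff C k).
  have := le_trans (normc_le_nrm _ i j) (iter_bounded C0 LC k X).
  move=> /(ler_wpM2r (ck k)) /le_trans -> //.
  by rewrite le_eqVlt; apply/orP; left; apply/eqP; rewrite /exp_coeff /=; ring.
have entry i j : Normc.normc ((expop L h X - (X + h%:C *: L X)) i j)
    <= h ^+ 2 * (2 * (nrm X * expR C)).
  have c0 : (h ^+ 0 / 0`!%:R)%:C = 1 :> R[i] by rewrite expr0 fact0 divr1.
  have c1 : (h ^+ 1 / 1`!%:R)%:C = h%:C by rewrite expr1 divr1.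
  have -> : h ^+ 2 * (2 * (nrm X * expR C))
      = h ^+ 2 * (nrm X * expR C) + h ^+ 2 * (nrm X * expR C) by ring.
  apply: le_trans (normc_le_ReIm _) _; apply: lerD.
    pose f k := complex.Re (((h ^+ k / k`!%:R)%:C *: iter k L X) i j).
    have -> : complex.Re ((expop L h X - (X + h%:C *: L X)) i j)
        = limn (series f) - (f 0%N + f 1%N).
      by rewrite /f !coefE c0 c1 mul1r !mxE RecB RecD.
    apply: lim_series_second_order; rewrite ?nrm_ge0 // => k.
    rewrite /f coefE RecZ normrM ger0_norm // mulrC.
    by apply: le_trans (iterC k i j); rewrite ler_wpM2r // Rec_le_normc.
  pose f k := complex.Im (((h ^+ k / k`!%:R)%:C *: iter k L X) i j).
  have -> : complex.Im ((expop L h X - (X + h%:C *: L X)) i j)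
      = limn (series f) - (f 0%N + f 1%N).
    by rewrite /f !coefE c0 c1 mul1r !mxE ImcB ImcD.
  apply: lim_series_second_order; rewrite ?nrm_ge0 // => k.
  rewrite /f coefE ImcZ normrM ger0_norm // mulrC.
  by apply: le_trans (iterC k i j); rewrite ler_wpM2r // Imc_le_normc.
rewrite {1}/nrm.
apply: (@le_trans _ _ (\sum_(i < N) \sum_(j < N) h ^+ 2 * (2 * (nrm X * expR C)))).
  by apply: ler_sum => i _; apply: ler_sum => j _.
move: (2 * _) => y; rewrite !sumr_const !card_ord -(mulr_natr (_ *+ N)).
by rewrite -(mulr_natr (h ^+ 2 * y)) -!mulrA [y * _]mulrC -!mulrA.
Qed.

(** Positivity is complete positivity at k = 1. A single block has size \sum_(a < 1) N and not
    literally N, so quadratic forms are compared instead of matrices. *)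
Lemma channel_state (Phi : M -> M) X :
  quantum_channel Phi -> state X -> state (Phi X).
Proof.
move=> [_ cp tp] [pX tX]; split; last by rewrite tp.
have quad1 (u : 'I_1 -> 'cV[R[i]]_N) (Y : M) :
    (\mxcol_(a < 1) u a)^t* *m (\mxblock_(a < 1, b < 1) Y) *m \mxcol_(a < 1) u a
    = (u 0)^t* *m Y *m u 0.
  rewrite tr_mxcol; have -> : map_mx Num.conj (\mxrow_a (u a)^T)
      = \mxrow_a (u a)^t* by apply/matrixP => i k; rewrite !mxE.
  by rewrite mul_mxrow_mxblock mul_mxrow_mxcol !big_ord1.
have pX1 : psdmx (\mxblock_(a < 1, b < 1) X).
  by move=> v; rewrite -[v]submxcolK quad1.
have /= := cp 1%N _ pX1.
rewrite (@eq_mxblock _ _ _ (fun=> N) (fun=> N) _ (fun _ _ => Phi X)); last first.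
  by move=> a b; rewrite mxblockK.
by move=> pY v; have := pY (\mxcol_(a < 1) v); rewrite quad1.
Qed.

Lemma unitary_state U X : U *m U^t* = 1%:M -> state X -> state (U *m X *m U^t*).
Proof.
move=> uU [pX tX]; split.
  by rewrite -{1}(trmxCK U); apply: psd_conj.
by rewrite -mulmxA mxtrace_mulC -mulmxA (mulmx1C uU) mulmx1.
Qed.

Lemma relative_entropyE X (sigma : M) : relative_entropy X sigma
  = negentropy X - complex.Re (\tr (X *m logmx sigma)).
Proof. by rewrite /relative_entropy mulmxBr linearB RecB. Qed.

(** The negentropy does not increase, so the error [e] meets only the linear functional tr(X log
    sigma) and is multiplied by the norm of log sigma. *)
Lemma relative_entropy_unitary (sigma : M) H U X (h e : R) :
  psdmx sigma -> \rank sigma = N -> state X -> U *m U^t* = 1%:M -> 0 <= h ->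
  nrm (U *m X *m U^t* - X - h%:C *: (- 'i *: commutator X H)) <= e ->
  relative_entropy (U *m X *m U^t*) sigma <= relative_entropy X sigma
    + h * opnorm (invsqrtmx sigma *m commutator H sigma *m invsqrtmx sigma)
    + e * nrm (logmx sigma).
Proof.
move=> ps rs sX uU h0; set D := _ - _ - _ => De.
have YE : U *m X *m U^t* = X + h%:C *: (- 'i *: commutator X H) + D.
  by rewrite /D -(addrA (U *m X *m U^t*)) -opprD subrKC.
have := commutator_logmx_le H ps rs sX.
set K := opnorm _; rewrite tr_mul_commutator -/(commutator X H) => cK.
rewrite !relative_entropyE; set S := logmx sigma in cK *.
have nU := negentropy_unitary sX.1 uU.
have trE : complex.Re (\tr (U *m X *m U^t* *m S)) = complex.Re (\tr (X *m S))
    - h * complex.Re ('i * \tr (commutator X H *m S)) + complex.Re (\tr (D *m S)).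
  rewrite YE; move: (D) (commutator X H) => D' C'.
  rewrite !mulmxDl -!scalemxAl !mxtraceD !mxtraceZ !RecD RecZ.
  by rewrite mulNr RecN mulrN.
have DS : - complex.Re (\tr (D *m S)) <= e * nrm S.
  apply: le_trans (ler_norm _) _; rewrite normrN.
  apply: le_trans (Re_tr_le_nrm _) _; apply: le_trans (nrmM _ _) _.
  by rewrite ler_wpM2r ?nrm_ge0.
rewrite trE; move: DS nU (ler_wpM2l h0 cK); clear.
move: (complex.Re _) (negentropy _) (negentropy _) (complex.Re _) (complex.Re _) => a b c d f.
lra.
Qed.

(* [Z] is obtained from [X] by conjugation with a Cayley transform, which is
   exactly unitary and agrees with the Hamiltonian flow to first order, followed
   by [expop L h]. *)
Lemma trotter_step (L : {linear M -> M}) (sigma : M) (alpha B : R) :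
  lindbladian L -> psdmx sigma -> \rank sigma = N -> mlsi L sigma alpha ->
  0 <= B -> exists2 C : R, 0 <= C & forall h H X,
    0 <= h <= 1 -> h * B <= 1 -> H^t* = H -> nrm H <= B -> state X ->
    exists Z, [/\ state Z,
      nrm (Z - X - h%:C *: (- 'i *: commutator X H + L X)) <= C * h ^+ 2 &
      relative_entropy Z sigma <= expR (- alpha * h) * (relative_entropy X sigma
        + h * opnorm (invsqrtmx sigma *m commutator H sigma *m invsqrtmx sigma)
        + C * h ^+ 2)].
Proof.
move=> lL ps rs hL B0; have [CL CL0 LC] := linear_bounded L.
have N0 : 0 <= N%:R :> R by [].
(* [c1] bounds the Cayley error, [c2] the remainder of the exponential, [c3] the effect of applying
   L to Y instead of X, and [c4] the Cayley error as seen by the entropy. *)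
pose c1 := cayley_const * B ^+ 2 * N%:R.
pose c2 := N%:R * N%:R * (2 * (N%:R * expR CL)) : R.
pose c3 := CL * (2 * B * N%:R + c1); pose c4 := c1 * nrm (logmx sigma).
have cc0 : 0 <= cayley_const.
  by rewrite /cayley_const !addr_ge0 ?mulr_ge0 ?addr_ge0 ?exprn_ge0.
have c10 : 0 <= c1 by rewrite !mulr_ge0 ?exprn_ge0.
have c20 : 0 <= c2 by rewrite !mulr_ge0 ?expR_ge0.
have c30 : 0 <= c3 by rewrite !(mulr_ge0, addr_ge0).
have c40 : 0 <= c4 by rewrite mulr_ge0 ?nrm_ge0.
exists (c1 + c2 + c3 + c4); first by rewrite !addr_ge0.
move=> h H X h01 hB hH nH sX; have [h0 h1] := andP h01.
have nX := state_nrm_le sX; have X0 := nrm_ge0 X; have H0 := nrm_ge0 H.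
(* The Cayley transform of A is 1 + 2iA to first order, hence the half step; h B <= 1 makes nrm A at
   most 1/2. *)
pose A := (h / 2)%:C *: H.
have hA : A^t* = A by rewrite trmxCZ hH conjc_real.
have nA : nrm A = h / 2 * nrm H by rewrite nrmZ normc_real ger0_norm // divr_ge0.
have nA2 : nrm A <= 2^-1.
  have := le_trans (ler_wpM2l h0 nH) hB; rewrite nA; lra.
have [U uU Ustep] := cayley_step hA nA2; set Y := U *m X *m U^t* in Ustep *.
have sY : state Y by exact: unitary_state.
pose G := - 'i *: commutator X H.
have GE : (2 * 'i) *: (A *m X - X *m A) = h%:C *: G.
  rewrite /A /G /commutator -scalemxAl -scalemxAr -scalerBr !scalerA.
  rewrite -[X *m H - _]opprB scalerN -scaleNr; congr (_ *: _).
  by apply/eqP; rewrite eq_complex /=; apply/andP; split; apply/eqP; field.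
have YX : nrm (Y - X - h%:C *: G) <= c1 * h ^+ 2.
  rewrite -GE; apply: le_trans (Ustep X) _; rewrite nA /c1.
  have -> : cayley_const * B ^+ 2 * N%:R * h ^+ 2
      = cayley_const * (h * B) ^+ 2 * N%:R by ring.
  apply: ler_pM => //; first by rewrite mulr_ge0 ?sqr_ge0.
  rewrite ler_wpM2l // lerXn2r ?nnegrE ?mulr_ge0 ?divr_ge0 //.
  have := ler_wpM2l h0 nH; have := mulr_ge0 h0 H0; lra.
have nG : nrm G <= 2 * B * N%:R.
  rewrite nrmZ normcN normc_i mul1r /commutator; apply: le_trans (nrmB _ _) _.
  have := nrmM X H; have := nrmM H X.
  have : nrm X * nrm H <= N%:R * B by rewrite ler_pM.
  lra.
have nYX : nrm (Y - X) <= h * (2 * B * N%:R + c1).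
  rewrite -[Y - X](subrK (h%:C *: G)); apply: le_trans (nrmD _ _) _.
  rewrite nrmZ normc_real ger0_norm // mulrDr addrC; apply: lerD.
    by rewrite ler_wpM2l.
  apply: le_trans YX _; rewrite mulrC ler_wpM2r // expr2 ler_piMl //.
exists (expop L h Y); split.
- by apply: channel_state => //; apply: lL.
- have nY := state_nrm_le sY.
  have -> : expop L h Y - X - h%:C *: (G + L X)
    = (expop L h Y - (Y + h%:C *: L Y)) + (Y - X - h%:C *: G)
      + h%:C *: L (Y - X).
    rewrite linearB scalerDr scalerBr; move: (expop L h Y) (h%:C *: _) => E V.
    by apply/matrixP => i j; rewrite !mxE; ring.
  apply: le_trans (nrmD _ _) _; apply: (@le_trans _ _ ((c2 + c1) * h ^+ 2 + c3 * h ^+ 2)).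
    apply: lerD.
      apply: le_trans (nrmD _ _) _; rewrite mulrDl; apply: lerD => //.
      apply: le_trans (expop_second_order Y CL0 LC h01) _.
      rewrite mulrC ler_wpM2r ?exprn_ge0 // /c2 ler_wpM2l ?mulr_ge0 //.
      by rewrite ler_wpM2l // ler_wpM2r ?expR_ge0.
    rewrite nrmZ normc_real ger0_norm //.
    have -> : c3 * h ^+ 2 = h * (CL * (h * (2 * B * N%:R + c1))) by rewrite /c3; ring.
    by rewrite ler_wpM2l //; apply: le_trans (LC _) _; rewrite ler_wpM2l.
  have : 0 <= c4 * h ^+ 2 by rewrite mulr_ge0 ?exprn_ge0.
  lra.
- apply: le_trans (hL _ _ sY h0) _; rewrite ler_wpM2l ?expR_ge0 //.
  apply: le_trans (relative_entropy_unitary ps rs sX uU h0 YX) _.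
  rewrite lerD2l.
  have -> : c1 * h ^+ 2 * nrm (logmx sigma) = c4 * h ^+ 2 by rewrite /c4; ring.
  by rewrite ler_wpM2r ?exprn_ge0 // lerDr !addr_ge0.
Qed.

End OneStep.

(** * Uniform continuity and Riemann sums *)

Section UniformContinuity.
Variable R : realType.
Implicit Types (t x y e : R) (d : R -> R -> R).

(* Heine's theorem is stated for a pseudometric [d], the distance between two
   values of a path, so as to apply to matrix-valued paths. *)
Lemma heine_bounded t d : (forall x y z, d x z <= d x y + d y z) ->
  (forall x, 0 <= x <= t -> forall e, 0 < e -> exists2 r : R, 0 < r &
     forall y, 0 <= y <= t -> `|x - y| < r -> d x y < e) ->
  exists K, forall x, 0 <= x <= t -> d 0 x <= K.
Proof.
move=> dtri dcont.
have := (compact_near_coveringP _).1 (@segment_compact _ 0 t) R (pinfty_nbhs R)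
  (fun K x => 0 <= x <= t -> d 0 x <= K) _.
have cov x : `[0, t]%classic x ->
    \forall x' \near x & K \near pinfty_nbhs R, 0 <= x' <= t -> d 0 x' <= K.
  rewrite /= in_itv /= => x01; have [r r0 rP] := dcont x x01 1 ltr01.
  exists (ball x r, [set K | d 0 x + 1 < K]); first split => /=.
  - exact: nbhsx_ballx.
  - by exists (d 0 x + 1); split; first exact: num_real.
  case=> y K /= [xy dK] y01; apply: le_trans (dtri 0 x y) _.
  by apply: le_trans (ltW dK); rewrite lerD2l ltW // rP.
move=> /(_ _ cov) H; near (pinfty_nbhs R) => K; exists K => x x01.
by have := near H K; apply => //=.
Unshelve. all: by end_near. Qed.

Lemma heine_uniform t d : (forall x y, d x y = d y x) ->
  (forall x y z, d x z <= d x y + d y z) ->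
  (forall x, 0 <= x <= t -> forall e, 0 < e -> exists2 r : R, 0 < r &
     forall y, 0 <= y <= t -> `|x - y| < r -> d x y < e) ->
  forall e, 0 < e -> exists2 r : R, 0 < r &
    forall x y, 0 <= x <= t -> 0 <= y <= t -> `|x - y| < r -> d x y < e.
Proof.
move=> dC dtri dcont e e0.
pose P (r x : R) := forall y, 0 <= x <= t -> 0 <= y <= t -> `|x - y| < r -> d x y < e.
have cov x : `[0, t]%classic x -> \forall x' \near x & r \near 0^'+, P r x'.
  rewrite /= in_itv /= => x01.
  have [r r0 rP] := dcont x x01 (e / 2) (divr_gt0 e0 (ltr0n _ 2)).
  have r2 : 0 < r / 2 by rewrite divr_gt0.
  exists (ball x (r / 2), [set s | s < r / 2]); first split => /=.
  - exact: nbhsx_ballx.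
  - exact: nbhs_right_lt.
  case=> y s /= [xy sr] z y01 z01 yz.
  rewrite (splitr e); apply: le_lt_trans (dtri y x z) _; rewrite dC.
  move: xy; rewrite /ball /= => xy.
  apply: ltrD; apply: rP => //; first by lra.
  have := ler_distD y x z; lra.
have H : \forall r \near 0^'+, `[0, t]%classic `<=` P r.
  exact: ((compact_near_coveringP _).1 (@segment_compact _ 0 t)).
near (0 : R)^'+ => r; exists r; first by near: r; exact: nbhs_right_gt.
move=> x y x01 y01; have : (`[0, t]%classic `<=` P r) by near: r.
by move=> /(_ x); rewrite /= in_itv /= => /(_ x01); apply.
Unshelve. all: by end_near. Qed.

(** On each cell f is at least its left value minus e / t, and these losses integrate to e.
    Half-open cells let the integrals add up without overlap. *)
Lemma riemann_sum_le t (f : R -> R) : 0 < t ->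
  (forall e, 0 < e -> exists2 r : R, 0 < r & forall x y,
     0 <= x <= t -> 0 <= y <= t -> `|x - y| < r -> `|f x - f y| < e) ->
  forall e, 0 < e -> exists2 r : R, 0 < r & forall n, (0 < n)%N -> t / n%:R < r ->
    \sum_(0 <= k < n) t / n%:R * f (k%:R * (t / n%:R))
      <= \int[lebesgue_measure]_(x in `[0, t]) f x + e.
Proof.
move=> t0 uf e e0; have [r r0 rP] := uf (e / t) (divr_gt0 e0 t0).
exists r => // n n0 hr; set h := t / n%:R in hr *.
have n0' : 0 < n%:R :> R by rewrite ltr0n.
have h0 : 0 < h by rewrite divr_gt0.
have nh : n%:R * h = t by rewrite mulrC divfK // gt_eqF.
have cf : {within `[0, t], continuous f}.
  apply/subspace_continuousP => x; rewrite /= in_itv /= => x01.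
  apply/cvgrPdist_lt => u u0; have [s s0 sP] := uf u u0.
  rewrite near_withinE; near=> y => /=; rewrite in_itv /= => y01.
  apply: sP => //; near: y; exact: nbhsx_ballx.
have If : lebesgue_measure.-integrable `[0, t] (EFin \o f).
  by apply: continuous_compact_integrable => //; exact: segment_compact.
have bnd k : (k <= n)%N -> 0 <= k%:R * h <= t.
  by move=> kn; rewrite mulr_ge0 ?(ltW h0) //= -[leRHS]nh ler_pM2r // ler_nat.
have IS (a b : itv_bound R) : [set` Interval a b] `<=` `[0, t] ->
    lebesgue_measure.-integrable [set` Interval a b] (EFin \o f).
  by move=> S; apply: integrableS If.
have claim k : (k <= n)%N -> \sum_(0 <= j < k) h * (f (j%:R * h) - e / t)
    <= \int[lebesgue_measure]_(x in `[0, k%:R * h]) f x.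
  elim: k => [|k IH] kn.
    by rewrite big_geq // mul0r set_itv1 Rintegral_set1.
  rewrite big_nat_recr //=.
  have kh := bnd _ (ltnW kn); have kh1 := bnd _ kn.
  have kk : k.+1%:R * h = k%:R * h + h by rewrite -natr1 mulrDl mul1r.
  have sub1 : `[0, k.+1%:R * h]%classic `<=` `[0, t]%classic.
    by move=> x; rewrite /= !in_itv /=; lra.
  have sub2 : `]k%:R * h, k.+1%:R * h]%classic `<=` `[0, t]%classic.
    by move=> x; rewrite /= !in_itv /=; lra.
  have l1 : (BLeft 0 <= BRight (k%:R * h))%O by rewrite bnd_simp; case/andP: kh.
  have l2 : (BRight (k%:R * h) <= BRight (k.+1%:R * h))%O.
    by rewrite bnd_simp kk lerDl ltW.
  have /eqP := Rintegral_itvB (IS _ _ sub1) l1 l2; rewrite subr_eq => /eqP ->.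
  rewrite addrC; apply: lerD; last exact: IH (ltnW kn).
  have -> : h * (f (k%:R * h) - e / t) =
    \int[lebesgue_measure]_(x in `]k%:R * h, k.+1%:R * h]) (f (k%:R * h) - e / t).
    have mE : (@lebesgue_measure R) `]k%:R * h, k.+1%:R * h]%classic = h%:E.
      by rewrite lebesgue_measure_itv /= lte_fin kk ltrDl h0 -EFinB addrAC subrr add0r.
    rewrite [LHS]mulrC; apply/esym; apply: etrans (Rintegral_cst _ _ _) _ => //.
    by congr (_ * _); exact: (congr1 fine mE).
  apply: le_Rintegral => //.
  - have Ic : lebesgue_measure.-integrable `[0, t]
        (EFin \o (fun=> f (k%:R * h) - e / t)).
      apply: continuous_compact_integrable; first exact: segment_compact.
      by apply: continuous_subspaceT; exact: cst_continuous.
    by apply: integrableS Ic.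
  - exact: IS.
  - move=> x; rewrite /= in_itv /= => xk.
    have : `|f (k%:R * h) - f x| < e / t by apply: rP => //; [lra|rewrite distrC ger0_norm; lra].
    by rewrite ltr_norml => /andP[_]; lra.
have := claim n (leqnn n); rewrite nh.
suff -> : \sum_(0 <= j < n) h * (f (j%:R * h) - e / t)
    = \sum_(0 <= k < n) h * f (k%:R * h) - e by rewrite lerBlDr.
under eq_bigr do rewrite mulrBr.
rewrite sumrB; congr (_ - _); rewrite sumr_const_nat subn0 -mulr_natl mulrA nh.
by rewrite mulrC divfK // gt_eqF.
Unshelve. all: by end_near. Qed.

Lemma expR_npos_lipschitz (x y : R) : x <= 0 -> y <= 0 ->
  `|expR x - expR y| <= `|x - y|.
Proof.
wlog xy : x y / x <= y.
  move=> W x0 y0; have [/W->//|/ltW yx] := leP x y.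
  by rewrite distrC [leRHS]distrC W.
move=> x0 y0; rewrite distrC [leRHS]distrC !ger0_norm ?subr_ge0 ?ler_expR //.
have -> : expR x = expR y * expR (x - y) by rewrite -expRD addrC subrK.
rewrite -{1}[expR y]mulr1 -mulrBr; have := expR_ge1Dx (x - y) => h.
apply: (@le_trans _ _ (1 * (y - x))); last by rewrite mul1r.
apply: ler_pM; rewrite ?expR_ge0 ?subr_ge0 //.
- by rewrite -expR0 ler_expR subr_le0.
- by rewrite -expR0 ler_expR.
- lra.
Qed.

Lemma exp_weighted_uniform t (alpha K : R) (f : R -> R) : 0 < alpha ->
  (forall x, 0 <= x <= t -> 0 <= f x <= K) ->
  (forall e, 0 < e -> exists2 r : R, 0 < r & forall x y,
     0 <= x <= t -> 0 <= y <= t -> `|x - y| < r -> `|f x - f y| < e) ->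
  forall e, 0 < e -> exists2 r : R, 0 < r & forall x y,
     0 <= x <= t -> 0 <= y <= t -> `|x - y| < r ->
     `|expR (- alpha * (t - x)) * f x - expR (- alpha * (t - y)) * f y| < e.
Proof.
move=> a0 fK uf e e0; have [r1 r10 P1] := uf (e / 2) (divr_gt0 e0 (ltr0n _ 2)).
have K1 : 0 < alpha * `|K| + 1 by rewrite ltr_wpDl // mulr_ge0 // ltW.
exists (Num.min r1 (e / 2 / (alpha * `|K| + 1))); first by rewrite lt_min r10 !divr_gt0.
move=> x y xt yt; rewrite lt_min => /andP[/(P1 x y xt yt) fxy xy].
have [/andP[f0 fxK] expx expy] : [/\ 0 <= f x <= K,
    - alpha * (t - x) <= 0 & - alpha * (t - y) <= 0].
  split; first exact: fK.
    by rewrite mulNr oppr_le0 mulr_ge0 ?(ltW a0) // subr_ge0; case/andP: xt.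
  by rewrite mulNr oppr_le0 mulr_ge0 ?(ltW a0) // subr_ge0; case/andP: yt.
have dexp := expR_npos_lipschitz expx expy.
have ey1 : expR (- alpha * (t - y)) <= 1 by rewrite -expR0 ler_expR.
have dE : - alpha * (t - x) - - alpha * (t - y) = alpha * (x - y) by ring.
rewrite dE normrM gtr0_norm // in dexp.
move: dexp ey1 (expR_ge0 (- alpha * (t - y))); move: (expR _) (expR _) => v u uv v1 v0.
have -> : u * f x - v * f y = (u - v) * f x + v * (f x - f y) by ring.
apply: le_lt_trans (ler_normD _ _) _; rewrite !normrM (ger0_norm f0) (ger0_norm v0).
rewrite (splitr e); apply: ler_ltD; last first.
  by apply: le_lt_trans fxy; rewrite ler_piMl.
apply: (@le_trans _ _ (alpha * `|x - y| * `|K|)).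
  by apply: ler_pM => //; apply: le_trans fxK (ler_norm _).
rewrite mulrAC; apply: (@le_trans _ _ ((alpha * `|K| + 1) * (e / 2 / (alpha * `|K| + 1)))).
  by apply: ler_pM; rewrite ?mulr_ge0 ?(ltW a0) ?lerDl ?(ltW xy).
by rewrite mulrCA divff ?mulr1 // gt_eqF.
Qed.

(** Discrete Gronwall step from the error [E] at time [tk] to [P] at [tk + h]. Both local errors, C
    h^2 of the scheme and h q of the exact solution, cost at most h eta / 2, and 1 + D h <= e^(D h)
    absorbs the amplification. *)
Lemma euler_error_step (h D E eta C q P tk : R) : 0 <= h -> 0 <= D -> 0 <= eta ->
  0 <= tk -> C * h <= eta / 2 -> q <= eta / 2 ->
  E <= eta * tk * expR (D * tk) -> 0 <= E ->
  P <= C * h ^+ 2 + (E + h * (D * E)) + h * q ->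
  P <= eta * (tk + h) * expR (D * (tk + h)).
Proof.
move=> h0 D0 eta0 tk0 Ch qP EP E0 /le_trans; apply.
have exph : 1 + D * h <= expR (D * h) by exact: expR_ge1Dx.
have exp1 : 1 <= expR (D * (tk + h)).
  by rewrite -expR0 ler_expR mulr_ge0 // addr_ge0.
have a1 : C * h ^+ 2 <= h * (eta / 2).
  by rewrite expr2 mulrA mulrC ler_wpM2l.
have a2 : h * q <= h * (eta / 2) by rewrite ler_wpM2l.
have a3 : E + h * (D * E) <= eta * tk * expR (D * (tk + h)).
  have -> : E + h * (D * E) = E * (1 + D * h) by ring.
  rewrite (mulrDr D) expRD mulrA; apply: ler_pM => //.
  by rewrite addr_ge0 // mulr_ge0.
have a4 : h * eta <= eta * h * expR (D * (tk + h)).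
  by rewrite [h * eta]mulrC ler_peMr ?mulr_ge0.
have -> : eta * (tk + h) * expR (D * (tk + h))
  = eta * tk * expR (D * (tk + h)) + eta * h * expR (D * (tk + h)) by ring.
rewrite addrAC [leRHS]addrC; apply: lerD => //.
by apply: le_trans a4; rewrite (splitr eta) mulrDr lerD.
Qed.

End UniformContinuity.

(** * Paths of matrices and limits of states *)

Section MatrixPaths.
Variables (R : realType) (N : nat).
Local Notation M := 'M[R[i]]_N.
Implicit Types (F : R -> M) (t x y e : R).

Lemma mx_continuous_on_nrm F x : mx_continuous_on `[0, +oo[ F -> 0 <= x ->
  forall e, 0 < e -> exists2 r : R, 0 < r &
    forall y, 0 <= y -> `|x - y| < r -> nrm (F x - F y) < e.
Proof.
move=> cF x0 e e0.
have n0 : 0 < N.+1%:R :> R by [].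
(* There are N^2 entries with two parts each; N + 1 makes the final inequality strict, also for N =
   0. *)
pose u : R := e / (2 * N.+1%:R ^+ 2).
have u0 : 0 < u by rewrite divr_gt0 // mulr_gt0 // exprn_gt0.
have xI : `[0, +oo[%classic x by rewrite /= in_itv /= x0.
have H : \forall y \near within `[0, +oo[ (nbhs x), forall i j : 'I_N,
    `|complex.Re (F x i j) - complex.Re (F y i j)| < u /\
    `|complex.Im (F x i j) - complex.Im (F y i j)| < u.
  apply: filter_forall => i; apply: filter_forall => j.
  have [cR cI] := cF i j; apply: filterI.
    by move/subspace_continuousP: cR => /(_ x xI) /cvgrPdist_lt; apply.
  by move/subspace_continuousP: cI => /(_ x xI) /cvgrPdist_lt; apply.
move: H; rewrite near_withinE => -[r /= r0 rP]; exists r => // y y0 xy.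
have {}rP := rP y xy; rewrite /= in_itv /= y0 in rP; have {}rP := rP isT.
apply: (@le_lt_trans _ _ (\sum_(i < N) \sum_(j < N) (u + u))).
  apply: ler_sum => i _; apply: ler_sum => j _.
  apply: le_trans (normc_le_ReIm _) _; have [/ltW p /ltW q] := rP i j.
  by rewrite !mxE RecB ImcB lerD.
rewrite !sumr_const !card_ord -mulrnA -mulr_natr /u.
have NN : (N * N)%:R < N.+1%:R ^+ 2 :> R by rewrite -natrX ltr_nat ltn_mul.
have -> : e / (2 * N.+1%:R ^+ 2) + e / (2 * N.+1%:R ^+ 2) = e / N.+1%:R ^+ 2.
  by field.
by rewrite mulrAC ltr_pdivrMr ?exprn_gt0 // ltr_pM2l.
Qed.

Lemma nrm_dist_triangle F x y z :
  nrm (F x - F z) <= nrm (F x - F y) + nrm (F y - F z).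
Proof. by rewrite -[F x - F z](subrKA (F y)) nrmD. Qed.

Lemma mx_continuous_on_uniform F t : mx_continuous_on `[0, +oo[ F ->
  forall e, 0 < e -> exists2 r : R, 0 < r &
    forall x y, 0 <= x <= t -> 0 <= y <= t -> `|x - y| < r ->
      nrm (F x - F y) < e.
Proof.
move=> cF; apply: heine_uniform => [x y|x y z|x /andP[x0 _] e e0].
- exact: nrmBC.
- exact: nrm_dist_triangle.
- have [r r0 rP] := mx_continuous_on_nrm cF x0 e0.
  by exists r => // y /andP[y0 _]; exact: rP.
Qed.

Lemma mx_continuous_on_bounded F t : mx_continuous_on `[0, +oo[ F ->
  exists2 K, 0 <= K & forall x, 0 <= x <= t -> nrm (F x) <= K.
Proof.
move=> cF; have [|x /andP[x0 _] e e0|K KP] :=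
    @heine_bounded R t (fun x y => nrm (F x - F y)).
- exact: nrm_dist_triangle.
- have [r r0 rP] := mx_continuous_on_nrm cF x0 e0.
  by exists r => // y /andP[y0 _]; exact: rP.
exists (`|K| + nrm (F 0)); first by rewrite addr_ge0 ?nrm_ge0.
move=> x /KP Kx; rewrite -[F x](subrK (F 0)); apply: le_trans (nrmD _ _) _.
by rewrite lerD2r nrmBC (le_trans Kx) // ler_norm.
Qed.

Lemma psdmx_closed (A : M) : (forall e, 0 < e -> exists2 X, psdmx X & nrm (X - A) < e) ->
  psdmx A.
Proof.
move=> cA v; pose q (X : M) : R[i] := (v^t* *m X *m v) 0 0.
have qB X Y : q X - q Y = q (X - Y) by rewrite /q mulmxBr mulmxBl !mxE.
have qn X : Normc.normc (q X) <= nrm v * nrm X * nrm v.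
  apply: le_trans (normc_le_nrm _ _ _) _; apply: le_trans (nrmM _ _) _.
  by rewrite ler_wpM2r ?nrm_ge0 // (le_trans (nrmM _ _)) // nrm_adj.
pose V := nrm v * nrm v + 1.
have V0 : 0 < V by rewrite ltr_wpDl ?mulr_ge0 ?nrm_ge0.
have near e : 0 < e -> exists2 z : R[i], 0 <= z & Normc.normc (z - q A) <= e.
  move=> e0; have [X pX XA] := cA (e / V) (divr_gt0 e0 V0).
  have h := qn (X - A); rewrite -qB in h.
  exists (q X); first exact: pX.
  apply: le_trans h _.
  rewrite mulrAC; apply: (@le_trans _ _ (V * (e / V))).
    by rewrite ler_pM ?mulr_ge0 ?nrm_ge0 ?ltW // /V ltrDl.
  by rewrite mulrCA divff ?mulr1 // gt_eqF.
rewrite -/(q A) lecE /=; apply/andP; split.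
  rewrite -normr_le0; apply/ler_addgt0Pl => e e0; rewrite addr0.
  have [z] := near e e0; rewrite lecE /= => /andP[/eqP Iz _] zA.
  by apply: le_trans zA; apply: le_trans (Imc_le_normc _); rewrite ImcB Iz sub0r normrN.
apply/ler_addgt0Pr => e e0; have [z] := near e e0; rewrite lecE /= => /andP[_ Rz] zA.
have := le_trans (Rec_le_normc _) zA; rewrite RecB ler_norml; lra.
Qed.

(** The evolution equation does not mention positivity: its solution is recognized as a state by
    being a limit of states. *)
Lemma state_closed (A : M) :
  (forall e, 0 < e -> exists2 X, state X & nrm (X - A) < e) -> state A.
Proof.
move=> cA; split.
  by apply: psdmx_closed => e /cA[X [pX _] XA]; exists X.
apply/eqP; rewrite -subr_eq0; apply/eqP/Normc.eq0_normc/eqP.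
rewrite eq_le normc_ge0 andbT; apply/ler_addgt0Pl => e /cA[X [_ tX] XA].
rewrite addr0 -tX -linearB; apply: le_trans (normc_tr_le_nrm _) _.
by rewrite nrmBC ltW.
Qed.

(* Klein's inequality bounds [negentropy X] from below by an affine function of
   [X] that is arbitrarily close to [negentropy A] at [A]. *)
Lemma negentropy_lsc (A : M) (b : R) : state A ->
  (forall e, 0 < e -> exists X, [/\ state X, nrm (X - A) <= e & negentropy X <= b + e]) ->
  negentropy A <= b.
Proof.
have combine (x c nd nx na y v w : R) : x + c - c - nd <= nx -> nx <= b + v ->
    na <= y -> y - x <= w / 3 -> nd <= w / 3 -> v <= w / 3 -> na <= b + w.
  by move=> ? ? ? ? ? ?; lra.
move=> [pA tA] H; apply/ler_addgt0Pr => e e0.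
(* The three thirds pay for N d in Klein's inequality, for replacing X by A in the trace against
   [G], and for the slack in the hypothesis. As [G] depends only on A and [d], X may be chosen after
   it. *)
have d0 : 0 < e / 3 / N.+1%:R by rewrite !divr_gt0.
set d := e / 3 / N.+1%:R in d0; set G := funmx (fun x => ln (x + d)) A.
have G0 : 0 < nrm G + 1 by rewrite ltr_wpDl ?nrm_ge0.
pose u := Num.min (e / 3) (e / 3 / (nrm G + 1)).
have u0 : 0 < u by rewrite lt_min !divr_gt0.
have [X [[pX tX] XA nX]] := H u u0.
have := klein_inequality pX pA (_ : 1%:M *m 1%:M^t* = 1%:M) d0.
rewrite trmxC1 !mul1mx mulmx1 tA tX -/G => /(_ erefl) kl.
have reg := negentropy_regularized pA d0; rewrite -/G in reg.
have diff : complex.Re (\tr (A *m G)) - complex.Re (\tr (X *m G)) <= e / 3.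
  rewrite -RecB -linearB -mulmxBl; apply: le_trans (ler_norm _) _.
  apply: le_trans (Re_tr_le_nrm _) _; apply: le_trans (nrmM _ _) _.
  rewrite nrmBC; apply: (@le_trans _ _ (e / 3 / (nrm G + 1) * (nrm G + 1))).
    apply: ler_pM; rewrite ?nrm_ge0 ?lerDl //.
    by apply: le_trans XA _; rewrite ge_min lexx orbT.
  by rewrite divfK // gt_eqF.
have Nd : N%:R * d <= e / 3.
  by rewrite /d mulrCA ger_pMr ?divr_gt0 // ler_pdivrMr // mul1r ler_nat.
have ue : u <= e / 3 by rewrite ge_min lexx.
exact: combine kl nX reg diff Nd ue.
Qed.

Lemma relative_entropy_lsc (A sigma : M) (b : R) : state A ->
  (forall e, 0 < e -> exists X,
     [/\ state X, nrm (X - A) <= e & relative_entropy X sigma <= b + e]) ->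
  relative_entropy A sigma <= b.
Proof.
move=> sA H; rewrite relative_entropyE lerBlDr; apply: negentropy_lsc => // e e0.
set S := logmx sigma; have S0 := nrm_ge0 S.
have S1 : 0 < 1 + nrm S by rewrite ltr_pwDl.
have u0 : 0 < e / (1 + nrm S) by rewrite divr_gt0.
have [X [sX XA]] := H _ u0; rewrite relative_entropyE -/S lerBlDr => nX.
have ue : e / (1 + nrm S) <= e by rewrite ler_pdivrMr // ler_peMr ?lerDl // ltW.
exists X; split=> //; first exact: le_trans XA ue.
apply: le_trans nX _; rewrite -!addrA lerD2l.
rewrite -[complex.Re (\tr (X *m S))](subrK (complex.Re (\tr (A *m S)))).
rewrite addrA [leRHS]addrC lerD2r -RecB -linearB -mulmxBl.
apply: (@le_trans _ _ (e / (1 + nrm S) + e / (1 + nrm S) * nrm S)).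
  rewrite lerD2l; apply: le_trans (ler_norm _) _; apply: le_trans (Re_tr_le_nrm _) _.
  by apply: le_trans (nrmM _ _) _; rewrite ler_wpM2r.
by rewrite -[X in X + _]mulr1 -mulrDr divfK // gt_eqF.
Qed.

(** The mean value theorem is applied to each real component, with its own intermediate point; hence
    an oscillation bound on all of [a, b] and the factor 2 N^2. Derivatives are used only inside the
    interval, which admits a = 0. *)
Lemma solution_increment (F G : R -> M) (a b e : R) :
  mx_continuous_on `[0, +oo[ F ->
  (forall s, 0 < s -> mx_is_derive F s (G s)) ->
  0 <= a <= b -> 0 <= e ->
  (forall c, a <= c <= b -> nrm (G c - G a) <= e) ->
  nrm (F b - F a - (b - a)%:C *: G a) <= (b - a) * (2 * (N%:R * N%:R) * e).
Proof.
move=> cF dF /andP[a0 ab] e0 Ge.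
have sub : `[a, b]%classic `<=` `[0, +oo[%classic.
  by move=> x; rewrite /= !in_itv /= => /andP[ax _]; rewrite (le_trans a0).
have ba0 : 0 <= b - a by rewrite subr_ge0.
have entry i j : Normc.normc ((F b - F a - (b - a)%:C *: G a) i j)
    <= (b - a) * e + (b - a) * e.
  have mxBZ (X Y Z : M) (r : R) : (X - Y - r%:C *: Z) i j
    = X i j - Y i j - r%:C * Z i j by rewrite !mxE.
  apply: le_trans (normc_le_ReIm _) _; rewrite mxBZ; apply: lerD.
    have [||c] := @MVT_segment R (fun s => complex.Re (F s i j))
      (fun s => complex.Re (G s i j)) a b ab.
    - move=> x; rewrite in_itv /= => /andP[ax _].
      exact: (dF x (le_lt_trans a0 ax) i j).1.
    - by apply: continuous_subspaceW sub _; exact: (cF i j).1.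
    rewrite in_itv /= => /Ge Gc Fc; rewrite !RecB Fc RecZ [_ * (b - a)]mulrC.
    rewrite -mulrBr normrM (ger0_norm ba0) ler_wpM2l //.
    apply: le_trans Gc; rewrite -RecB; apply: le_trans (Rec_le_normc _) _.
    by have := normc_le_nrm (G c - G a) i j; rewrite !mxE.
  have [||c] := @MVT_segment R (fun s => complex.Im (F s i j))
    (fun s => complex.Im (G s i j)) a b ab.
  - move=> x; rewrite in_itv /= => /andP[ax _].
    exact: (dF x (le_lt_trans a0 ax) i j).2.
  - by apply: continuous_subspaceW sub _; exact: (cF i j).2.
  rewrite in_itv /= => /Ge Gc Fc; rewrite !ImcB Fc ImcZ [_ * (b - a)]mulrC.
  rewrite -mulrBr normrM (ger0_norm ba0) ler_wpM2l //.
  apply: le_trans Gc; rewrite -ImcB; apply: le_trans (Imc_le_normc _) _.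
  by have := normc_le_nrm (G c - G a) i j; rewrite !mxE.
apply: (@le_trans _ _ (\sum_(i < N) \sum_(j < N) ((b - a) * e + (b - a) * e))).
  by apply: ler_sum => i _; apply: ler_sum => j _; exact: entry.
have -> : (b - a) * (2 * (N%:R * N%:R) * e)
    = ((b - a) * e + (b - a) * e) * N%:R * N%:R by ring.
by rewrite !sumr_const !card_ord !mulr_natr.
Qed.

Lemma nrm_commutator (X Y : M) : nrm (commutator X Y) <= 2 * (nrm X * nrm Y).
Proof.
apply: le_trans (nrmB _ _) _; rewrite mulr2n mulrDl mul1r.
by apply: lerD; rewrite ?nrmM // mulrC nrmM.
Qed.

Lemma commutatorBl (X Y Z : M) :
  commutator (X - Y) Z = commutator X Z - commutator Y Z.
Proof. by rewrite /commutator mulmxBl mulmxBr !opprB addrACA [RHS]addrACA [- (Z *m X) + _]addrC. Qed.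

Lemma commutatorBr (X Y Z : M) :
  commutator Z (X - Y) = commutator Z X - commutator Z Y.
Proof. by rewrite /commutator mulmxBl mulmxBr !opprB addrACA [RHS]addrACA [- (X *m Z) + _]addrC. Qed.

Lemma opnorm_dist (X Y : M) : `|opnorm X - opnorm Y| <= nrm (X - Y) * N%:R.
Proof.
have := opnorm_lipschitz X Y; have := opnorm_lipschitz Y X.
by rewrite (nrmBC Y) ler_norml; move: (opnorm X) (opnorm Y) (_ * _) => a b c; lra.
Qed.

(** The source of continuity in time of the integrand: the commutator is linear in the Hamiltonian
    and [opnorm] is Lipschitz for [nrm]. *)
Lemma opnorm_sandwich_dist (I Z X Y : M) :
  `|opnorm (I *m commutator X Z *m I) - opnorm (I *m commutator Y Z *m I)|
    <= nrm I * (2 * nrm Z) * nrm I * N%:R * nrm (X - Y).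
Proof.
apply: le_trans (opnorm_dist _ _) _.
rewrite -mulmxBl -mulmxBr -commutatorBl [leRHS]mulrAC ler_wpM2r //.
move: (X - Y) => D.
apply: le_trans (nrmM _ _) _; rewrite [leRHS]mulrAC ler_wpM2r ?nrm_ge0 //.
apply: le_trans (nrmM _ _) _; rewrite -mulrA ler_wpM2l ?nrm_ge0 //.
by apply: le_trans (nrm_commutator _ _) _; rewrite -mulrA [nrm D * _]mulrC.
Qed.

(** Here x and u are the current approximate and exact values, z and t' the next ones, g and v their
    first-order increments: the error splits into that of the scheme, the propagated one and that of
    the exact solution. *)
Lemma telescope_error (z t' x g u v : M) :
  z - t' = (z - x - g) + ((x - u) + (g - v)) - (t' - u - v).
Proof. by apply/matrixP => i j; rewrite !mxE; ring. Qed.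

Lemma subrDD (p q u v : M) : p + u - (q + v) = (p - q) + (u - v).
Proof. by rewrite opprD addrACA. Qed.

Lemma small_step (t r : R) : 0 < t -> 0 < r ->
  exists2 n, (0 < n)%N & t / n%:R < r.
Proof.
move=> t0 r0; have tr := archi_boundP (divr_ge0 (ltW t0) (ltW r0)).
have n0 : 0 < (Num.bound (t / r))%:R :> R by apply: le_lt_trans tr; rewrite divr_ge0 ?ltW.
exists (Num.bound (t / r)); first by rewrite -(ltr0n R).
by rewrite ltr_pdivrMr // mulrC -ltr_pdivrMr.
Qed.

End MatrixPaths.

(** * Convergence of the product formula *)

Section DrivenEvolution.
Variables (R : realType) (N : nat) (L : {linear 'M[R[i]]_N -> 'M[R[i]]_N}).
Variables (sigma : 'M[R[i]]_N) (alpha : R) (H T : R -> 'M[R[i]]_N).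
Local Notation M := 'M[R[i]]_N.
Hypotheses (L_lindbladian : lindbladian L) (sigma_psd : psdmx sigma).
Hypotheses (sigma_rank : \rank sigma = N) (alpha_gt0 : 0 < alpha).
Hypothesis L_mlsi : mlsi L sigma alpha.
Hypothesis H_hermitian : forall s, 0 <= s -> H s \is hermsymmx.
Hypothesis H_continuous : mx_continuous_on `[0, +oo[ H.
Hypotheses (T0_state : state (T 0)) (T_continuous : mx_continuous_on `[0, +oo[ T).

Let S s X : M := - 'i *: commutator X (H s) + L X.

Hypothesis T_ode : forall s, 0 < s -> mx_is_derive T s (S s (T s)).

Let kappa s := opnorm (invsqrtmx sigma *m commutator (H s) sigma *m invsqrtmx sigma).

(** Provides the oscillation bound for [solution_increment], by splitting the commutators into
    [T_a - T_b, H_a] + [T_b, H_a - H_b]. *)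
Lemma generator_uniform t : forall e, 0 < e -> exists2 r : R, 0 < r &
  forall a b, 0 <= a <= t -> 0 <= b <= t -> `|a - b| < r ->
    nrm (S a (T a) - S b (T b)) <= e.
Proof.
move=> e e0; have [CL CL0 LC] := linear_bounded L.
have [BH BH0 HB] := mx_continuous_on_bounded t H_continuous.
have [BT BT0 TB] := mx_continuous_on_bounded t T_continuous.
pose D := 1 + 2 * BH + CL + 2 * BT; have D0 : 0 < D.
  by rewrite /D -!addrA ltr_pwDl // !addr_ge0 // mulr_ge0.
have u0 : 0 < e / D by rewrite divr_gt0.
have [r1 r10 P1] := mx_continuous_on_uniform t H_continuous u0.
have [r2 r20 P2] := mx_continuous_on_uniform t T_continuous u0.
exists (Num.min r1 r2); first by rewrite lt_min r10.
move=> a b at_ bt; rewrite lt_min => /andP[/(P1 a b at_ bt) /ltW dH /(P2 a b at_ bt) /ltW dT].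
have -> : S a (T a) - S b (T b) = - 'i *: (commutator (T a - T b) (H a)
    + commutator (T b) (H a - H b)) + L (T a - T b).
  have -> : L (T a - T b) = L (T a) - L (T b) by exact: linearB.
  by rewrite commutatorBl commutatorBr subrKA scalerBr; exact: subrDD.
apply: le_trans (nrmD _ _) _; rewrite nrmZ normcN normc_i mul1r.
apply: (@le_trans _ _ (2 * (e / D * BH) + 2 * (BT * (e / D)) + CL * (e / D))).
  apply: lerD; last by apply: le_trans (LC _) _; rewrite ler_wpM2l.
  apply: le_trans (nrmD _ _) _; apply: lerD.
    apply: le_trans (nrm_commutator _ _) _; rewrite ler_wpM2l //.
    by rewrite ler_pM ?nrm_ge0 // HB.
  apply: le_trans (nrm_commutator _ _) _; rewrite ler_wpM2l //.
  by rewrite ler_pM ?nrm_ge0 // TB.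
have -> : 2 * (e / D * BH) + 2 * (BT * (e / D)) + CL * (e / D)
    = e / D * (D - 1) by rewrite /D; ring.
by rewrite -[leRHS](divfK (lt0r_neq0 D0)) ler_wpM2l ?(ltW u0) // gerBl.
Qed.

Lemma kappa_uniform t : forall e, 0 < e -> exists2 r : R, 0 < r &
  forall a b, 0 <= a <= t -> 0 <= b <= t -> `|a - b| < r ->
    `|kappa a - kappa b| < e.
Proof.
move=> e e0; set C := nrm (invsqrtmx sigma) * (2 * nrm sigma) * nrm (invsqrtmx sigma) * N%:R.
have C0 : 0 <= C by rewrite !mulr_ge0 ?nrm_ge0.
have C1 : 0 < C + 1 by rewrite ltr_wpDl.
have [r r0 P] := mx_continuous_on_uniform t H_continuous (divr_gt0 e0 C1).
exists r => // a b at_ bt /(P a b at_ bt) dH.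
apply: le_lt_trans (opnorm_sandwich_dist _ _ _ _) _; rewrite -/C.
apply: (@le_lt_trans _ _ (C * (e / (C + 1)))); first by rewrite ler_wpM2l // ltW.
by rewrite mulrCA -[ltRHS]mulr1 ltr_pM2l // ltr_pdivrMr // mul1r ltrDl.
Qed.

Lemma kappa_bounded t : exists K, forall a, 0 <= a <= t -> 0 <= kappa a <= K.
Proof.
have [BH BH0 HB] := mx_continuous_on_bounded t H_continuous.
set C := nrm (invsqrtmx sigma) * (2 * nrm sigma) * nrm (invsqrtmx sigma) * N%:R.
have C0 : 0 <= C by rewrite !mulr_ge0 ?nrm_ge0.
exists (kappa 0 + C * (BH + nrm (H 0))) => a at_; apply/andP; split.
  exact: opnorm_ge0.
rewrite -lerBlDl; apply: le_trans (ler_norm _) _.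
apply: le_trans (opnorm_sandwich_dist _ _ _ _) _; rewrite -/C ler_wpM2l //.
by apply: le_trans (nrmB _ _) _; rewrite lerD2r HB.
Qed.

Lemma generator_bounded t : exists2 D : R, 0 <= D &
  forall a X, 0 <= a <= t -> nrm (- 'i *: commutator X (H a) + L X) <= D * nrm X.
Proof.
have [CL CL0 LC] := linear_bounded L.
have [BH BH0 HB] := mx_continuous_on_bounded t H_continuous.
exists (2 * BH + CL); first by rewrite addr_ge0 ?mulr_ge0.
move=> a X at_; apply: le_trans (nrmD _ _) _; rewrite mulrDl; apply: lerD => //.
rewrite nrmZ normcN normc_i mul1r; apply: le_trans (nrm_commutator _ _) _.
by rewrite -mulrA ler_wpM2l // mulrC ler_wpM2r ?nrm_ge0 ?HB.
Qed.

Lemma generatorB a X Y : - 'i *: commutator (X - Y) (H a) + L (X - Y)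
  = (- 'i *: commutator X (H a) + L X) - (- 'i *: commutator Y (H a) + L Y).
Proof.
have -> : L (X - Y) = L X - L Y by exact: linearB.
by rewrite commutatorBl scalerBr subrDD.
Qed.

Lemma trotter_approximation t e : 0 < t -> 0 < e -> exists X,
  [/\ state X, nrm (X - T t) <= e &
    relative_entropy X sigma <= expR (- alpha * t) * relative_entropy (T 0) sigma
      + \int[lebesgue_measure]_(x in `[0, t]) (expR (- alpha * (t - x)) * kappa x) + e].
Proof.
move=> t0 e0.
have [B B0 HB] := mx_continuous_on_bounded t H_continuous.
have [D D0 SD] := generator_bounded t.
have [C C0 step] := trotter_step L_lindbladian sigma_psd sigma_rank L_mlsi B0.
have [K kK] := kappa_bounded t.
have N0 : 0 <= N%:R :> R by [].
(* The Gronwall bound at time t is eta t e^(D t) = eta (Q - 1), which is below e for eta = e / Q. *)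
pose Q := t * expR (D * t) + 1.
have Q0 : 0 < Q by rewrite ltr_wpDl // mulr_ge0 ?expR_ge0 // ltW.
pose eta := e / Q; have eta0 : 0 < eta by rewrite divr_gt0.
pose NN : R := 2 * (N%:R * N%:R); have NN0 : 0 <= NN by rewrite !mulr_ge0.
pose e1 := eta / 2 / (NN + 1).
have e10 : 0 < e1 by rewrite !divr_gt0 // ltr_wpDl.
have e1P : NN * e1 <= eta / 2.
  rewrite /e1 mulrCA ger_pMr ?divr_gt0 // ler_pdivrMr ?ltr_wpDl // mul1r lerDl.
  exact: ler01.
have [r1 r10 P1] := generator_uniform t e10.
have e20 : 0 < e / 2 by rewrite divr_gt0.
have [r2 r20 P2] := riemann_sum_le t0 (exp_weighted_uniform alpha_gt0 kK (kappa_uniform t)) e20.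
(* [r3] makes C h at most eta / 2, [r4] makes the n entropy errors C h^2, in total t C h, at most e
   / 2, and [r5] gives both h B <= 1 and h <= 1. *)
pose r3 := eta / 2 / (C + 1); pose r4 := e / 2 / (t * C + 1); pose r5 := (B + 1)^-1.
have r30 : 0 < r3 by rewrite !divr_gt0 // ltr_wpDl.
have r40 : 0 < r4 by rewrite !divr_gt0 // ltr_wpDl // mulr_ge0 // ltW.
have r50 : 0 < r5 by rewrite invr_gt0 ltr_wpDl.
have rr : 0 < Num.min (Num.min r1 r2) (Num.min r3 (Num.min r4 r5)).
  by rewrite !lt_min r10 r20 r30 r40 r50.
have [n n0] := small_step t0 rr; rewrite !lt_min.
set h := t / n%:R => /andP[/andP[h1 h2] /and3P[h3 h4 h5]].
have n0' : 0 < n%:R :> R by rewrite ltr0n.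
have h0 : 0 < h by rewrite divr_gt0.
have h0' := ltW h0.
have nh : n%:R * h = t by rewrite mulrC divfK // gt_eqF.
have hB1 : h * (B + 1) <= 1.
  by rewrite -ler_pdivlMr ?ltr_wpDl // div1r ltW.
have hB : h * B <= 1 by apply: le_trans hB1; rewrite ler_wpM2l // lerDl.
have hh1 : h <= 1 by apply: le_trans hB1; rewrite ler_peMr // lerDr.
have Ch : C * h <= eta / 2.
  apply: (@le_trans _ _ ((C + 1) * r3)); first by rewrite ler_pM // ?lerDl // ltW.
  by rewrite mulrC divfK // gt_eqF // ltr_wpDl.
have tCh : t * C * h <= e / 2.
  have tC1 : 0 < t * C + 1 by rewrite ltr_wpDl // mulr_ge0 // ltW.
  apply: (@le_trans _ _ ((t * C + 1) * r4)).
    by rewrite ler_pM ?mulr_ge0 ?(ltW t0) ?lerDl ?(ltW h4).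
  by rewrite mulrC divfK // gt_eqF.
have bnd k : (k <= n)%N -> 0 <= k%:R * h <= t.
  by move=> kn; rewrite mulr_ge0 //= -[leRHS]nh ler_pM2r // ler_nat.
pose f x := expR (- alpha * (t - x)) * kappa x.
(* The entropy is weighted by the decay still to come until time t, so that each contraction factor
   is absorbed by the change of weight. *)
have claim k : (k <= n)%N -> exists X, [/\ state X,
    nrm (X - T (k%:R * h)) <= eta * (k%:R * h) * expR (D * (k%:R * h)) &
    expR (- alpha * (t - k%:R * h)) * relative_entropy X sigma
      <= expR (- alpha * t) * relative_entropy (T 0) sigma
         + \sum_(0 <= j < k) (h * f (j%:R * h) + C * h ^+ 2)].
  elim: k => [|k IH] kn.
    exists (T 0); split=> //; first by rewrite mul0r subrr nrm0 !(mulr0, mul0r).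
    by rewrite mul0r subr0 big_geq // addr0.
  have [X [sX XT XE]] := IH (ltnW kn).
  have kb := bnd k (ltnW kn); have [kb0 kb1] := andP kb.
  have kb' := bnd k.+1 kn; have [kb0' kb1'] := andP kb'.
  have kk : k.+1%:R * h = k%:R * h + h by rewrite -natr1 mulrDl mul1r.
  have [|||||Z [sZ ZX ZE]] := step h (H (k%:R * h)) X => //.
  - by rewrite h0' hh1.
  - exact/hermsymmx_herm/H_hermitian.
  - exact: HB.
  exists Z; split=> //.
    rewrite kk; apply: (@euler_error_step _ h D (nrm (X - T (k%:R * h))) eta C (NN * e1)) => //.
    - exact: ltW.
    - exact: nrm_ge0.
    rewrite (telescope_error _ _ X (h%:C *: (- 'i *: commutator X (H (k%:R * h)) + L X))
      (T (k%:R * h)) (h%:C *: S (k%:R * h) (T (k%:R * h)))).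
    apply: le_trans (nrmB _ _) _; apply: lerD.
      apply: le_trans (nrmD _ _) _; apply: lerD; first exact: ZX.
      apply: le_trans (nrmD _ _) _; rewrite lerD2l -scalerBr /S -generatorB.
      by rewrite nrmZ normc_real (ger0_norm h0') ler_wpM2l // SD.
    have := @solution_increment R N T (fun s => S s (T s)) (k%:R * h) (k%:R * h + h) e1
      T_continuous T_ode _ (ltW e10).
    have -> : k%:R * h + h - k%:R * h = h by rewrite addrAC subrr add0r.
    apply; first by rewrite kb0 lerDl.
    move=> c /andP[c1 c2]; apply: P1 => //.
      by rewrite (le_trans kb0) //= (le_trans c2) // -kk.
    by rewrite ger0_norm ?subr_ge0 //; apply: le_lt_trans h1; rewrite lerBlDl.
  rewrite big_nat_recr //= addrA.
  have wE : expR (- alpha * (t - k%:R * h))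
      = expR (- alpha * (t - k.+1%:R * h)) * expR (- alpha * h).
    by rewrite -expRD kk; congr expR; ring.
  (* Weights at most 1 let the errors C h^2 be added without discount; the operator norms keep
     theirs and form the Riemann sum. *)
  have w1 : expR (- alpha * (t - k%:R * h)) <= 1.
    rewrite -[leRHS]expR0 ler_expR mulNr oppr_le0; apply: mulr_ge0; first exact: ltW.
    by rewrite subr_ge0.
  apply: le_trans (ler_wpM2l (expR_ge0 _) ZE) _.
  rewrite mulrA -wE -/(kappa _) mulrDr mulrDr addrA.
  have Ch2 : 0 <= C * h ^+ 2 by rewrite mulr_ge0 // exprn_ge0.
  apply: lerD; last exact: ler_piMl Ch2 w1.
  by apply: lerD; last by rewrite /f mulrCA.
have [X [sX XT XE]] := claim n (leqnn n); exists X; split=> //.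
  rewrite nh in XT; apply: le_trans XT _.
  have -> : eta * t * expR (D * t) = eta * (Q - 1) by rewrite /Q addrK mulrA.
  rewrite -[leRHS](divfK (lt0r_neq0 Q0)) -/eta ler_wpM2l ?(ltW eta0) //.
  by rewrite gerBl.
move: XE; rewrite nh subrr mulr0 expR0 mul1r => /le_trans; apply.
rewrite -addrA lerD2l big_split /=.
have -> : \sum_(0 <= j < n) C * h ^+ 2 = t * C * h.
  by rewrite sumr_const_nat subn0 -mulr_natl -nh; ring.
by rewrite (splitr e) addrA; apply: lerD => //; exact: P2.
Qed.

Lemma relative_entropy_evolution t : 0 < t ->
  relative_entropy (T t) sigma <= expR (- alpha * t) * relative_entropy (T 0) sigma
    + \int[lebesgue_measure]_(x in `[0, t]) (expR (- alpha * (t - x)) * kappa x).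
Proof.
move=> t0; apply: relative_entropy_lsc => [|e e0].
  apply: state_closed => e e0.
  have [X [sX XT _]] := trotter_approximation t0 (divr_gt0 e0 (ltr0n _ 2)).
  by exists X => //; apply: le_lt_trans XT _; rewrite ltr_pdivrMr // ltr_pMr // ltr1n.
exact: trotter_approximation.
Qed.

End DrivenEvolution.

Theorem theorem1 (R : realType) (n : nat)
    (L : {linear 'M[R[i]]_(2 ^ n) -> 'M[R[i]]_(2 ^ n)})
    (sigma : 'M[R[i]]_(2 ^ n)) (alpha : R)
    (H : R -> 'M[R[i]]_(2 ^ n))
    (T : R -> 'M[R[i]]_(2 ^ n) -> 'M[R[i]]_(2 ^ n))
    (L_lindbladian : lindbladian L)
    (sigma_state : state sigma)
    (sigma_full_rank : \rank sigma = (2 ^ n)%N)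
    (sigma_fixed : fixed_point L sigma)
    (alpha_gt0 : 0 < alpha)
    (L_mlsi : mlsi L sigma alpha)
    (H_hermitian : forall s, 0 <= s -> H s \is hermsymmx)
    (H_continuous : mx_continuous_on `[0, +oo[ H)
    (T_evolution : is_evolution (driven_lindbladian L H) T) :
  forall (rho : 'M[R[i]]_(2 ^ n)) (t : R), state rho -> 0 < t ->
    relative_entropy (T t rho) sigma
      <= expR (- alpha * t) * relative_entropy rho sigma
         + \int[lebesgue_measure]_(tau in `[0, t])
             (expR (- alpha * (t - tau))
              * opnorm (invsqrtmx sigma *m commutator (H tau) sigma
                          *m invsqrtmx sigma)).
Proof.
move=> rho t s_rho t0; have [T0 Tc Tode] := T_evolution rho.
have := @relative_entropy_evolution R _ L sigma alpha H (fun s => T s rho).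
by rewrite /= T0; apply=> //; case: sigma_state.
Qed.
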